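(* Let $\mathcal{L}$ be a real line arrangement in $\mathbb{CP}^2$ consisting of $n$ lines, and choose the line at infinity (not in $\mathcal{L}$) such that all the lines of $\mathcal{L}$ intersect in $\mathbb{C}^2$, i.e. all intersection points of lines of $\mathcal{L}$ lie in $\mathbb{C}^2$. Assume that $\mathcal{L}$ has exactly $k\ge 1$ multiple intersection points, and that for every equivalence class of the relation $\sim$ on the multiple points, there is a line of $\mathcal{L}$ on which all the multiple points of that class lie. Then the fundamental groups $\pi_1(\mathbb{C}^2-\mathcal{L},u_0)$ and $\pi_1(\mathbb{CP}^2-\mathcal{L},u_0)$ are big.
   Context: A group $G$ is called big if it contains a subgroup isomorphic to $\mathbb{F}^2$, the free group on $2$ generators. A real line arrangement is a finite union of distinct projective lines in $\mathbb{CP}^2$, each of which can be defined by a linear equation with real coefficients; $\mathcal{L}$ denotes both the set of lines and their union. A multiple point is a point where more than two lines of the arrangement meet. The relation $\sim$ on the set of multiple points is defined by: $p\sim q$ if $p$ is connected to $q$ by a path whose vertices are multiple points, i.e. there is a finite sequence of multiple points from $p$ to $q$ (possibly the empty path, when $p=q$) in which any two consecutive points lie on a common line of $\mathcal{L}$; it is an equivalence relation. $u_0$ is a base point. *)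

(* Defs.v *)
From HB Require Import structures.
From mathcomp Require Import all_boot all_order all_algebra generic_quotient.
From mathcomp Require Import ring lra.
From mathcomp Require Import all_classical all_reals topology normedtype homotopy.
From mathcomp Require Import complex.

Set Implicit Arguments.
Unset Strict Implicit.
Unset Printing Implicit Defensive.

Import Order.TTheory GRing.Theory Num.Theory.
Import numFieldNormedType.Exports.

Local Open Scope classical_set_scope.
Local Open Scope ring_scope.
Local Open Scope quotient_scope.
Local Open Scope card_scope.

(** * Free groups, as reduced words *)

Section FreeGroup.
Variable A : choiceType.

(* [(a, true)] is the generator [a] and [(a, false)] its formal inverse. *)
Definition letter := (A * bool)%type.
Definition letterV (x : letter) : letter := (x.1, ~~ x.2).

Definition reduced (w : seq letter) := sorted (fun x y => x != letterV y) w.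

Record free_group := FreeGroup { word :> seq letter; _ : reduced word }.

HB.instance Definition _ := [isSub for word].
HB.instance Definition _ := [Choice of free_group by <:].

Definition reduced_cons (x : letter) (w : seq letter) : seq letter :=
  if w is y :: w' then if x == letterV y then w' else x :: w else [:: x].

(* The reduced form of the concatenation [u ++ v], for a reduced word [v]. *)
Definition reduced_cat (u v : seq letter) := foldr reduced_cons v u.

Lemma letterVK : involutive letterV.
Proof. by case=> a b; rewrite /letterV /= negbK. Qed.

Lemma reduced_cons_reduced x w : reduced w -> reduced (reduced_cons x w).
Proof.
case: w => [|y w] //= rw; have [_|ne] := eqVneq x (letterV y).
  exact: path_sorted rw.
by rewrite /reduced /= ne.
Qed.

Lemma reduced_cat_reduced u v : reduced v -> reduced (reduced_cat u v).
Proof. by move=> rv; elim: u => //= x u; exact: reduced_cons_reduced. Qed.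

Lemma reduced_consVK x w :
  reduced w -> reduced_cons x (reduced_cons (letterV x) w) = w.
Proof.
case: w => [|y w] /=; first by rewrite letterVK eqxx.
rewrite (inj_eq (inv_inj letterVK)); have [-> rw|ne rw] := eqVneq x y.
  case: w rw => //= z w /andP[ne _].
  by rewrite (negPf ne).
by rewrite /= letterVK eqxx.
Qed.

Lemma reduced_cat_cons x u v : reduced v ->
  reduced_cat (reduced_cons x u) v = reduced_cons x (reduced_cat u v).
Proof.
case: u => [|y u] //= rv; have [->|//] := eqVneq x (letterV y).
by rewrite -{2}(letterVK y) reduced_consVK //; exact: reduced_cat_reduced.
Qed.

Lemma reduced_catA u v w : reduced w ->
  reduced_cat u (reduced_cat v w) = reduced_cat (reduced_cat u v) w.
Proof. by move=> rw; elim: u => //= x u ->; rewrite reduced_cat_cons. Qed.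

Lemma reduced_cats0 u : reduced u -> reduced_cat u [::] = u.
Proof.
elim: u => //= x u IHu ru; rewrite IHu; last exact: path_sorted ru.
by case: u ru {IHu} => //= y u /andP[/negPf ->].
Qed.

Definition wordV (w : seq letter) := rev (map letterV w).

Lemma wordVK : involutive wordV.
Proof.
move=> w; rewrite /wordV map_rev revK -map_comp -[RHS]map_id.
by apply: eq_map => x /=; rewrite letterVK.
Qed.

Lemma wordV_reduced w : reduced w -> reduced (wordV w).
Proof.
rewrite /reduced /wordV rev_sorted sorted_map => rw.
apply: sub_sorted rw => x y ne.
by change (letterV y != letterV (letterV x)); rewrite letterVK eq_sym.
Qed.

Lemma reduced_catVw w : reduced_cat (wordV w) w = [::].
Proof.
elim: w => //= x w IHw; rewrite /wordV /= rev_cons /reduced_cat foldr_rcons /=.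
by rewrite eqxx.
Qed.

Definition free_one : free_group := @FreeGroup [::] isT.
Definition free_mul (u v : free_group) : free_group :=
  FreeGroup (reduced_cat_reduced u (valP v)).
Definition free_inv (u : free_group) : free_group :=
  FreeGroup (wordV_reduced (valP u)).

Lemma free_mulA : associative free_mul.
Proof. by move=> u v w; apply: val_inj; exact: reduced_catA (valP w). Qed.

Lemma free_mul1 : left_id free_one free_mul.
Proof. by move=> u; exact: val_inj. Qed.

Lemma free_mulr1 : right_id free_one free_mul.
Proof. by move=> u; apply: val_inj; exact: reduced_cats0 (valP u). Qed.

Lemma free_mulV : left_inverse free_one free_inv free_mul.
Proof. by move=> u; apply: val_inj; exact: reduced_catVw. Qed.

Lemma free_mulrV : right_inverse free_one free_inv free_mul.
Proof.
move=> u; apply: val_inj => /=; rewrite -{1}(wordVK u).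
exact: reduced_catVw.
Qed.

HB.instance Definition _ := isGroup.Build free_group
  free_mulA free_mul1 free_mulr1 free_mulV free_mulrV.

End FreeGroup.

Definition big_group (G : groupType) : Prop :=
  exists2 H : {pred G}, group_closed H &
    exists f : {multiplicative free_group 'I_2 -> G},
      set_bij [set: free_group 'I_2] [set x | x \in H] f.

(** * The fundamental group *)

Section UnitInterval.
Variable R : realType.

Definition unitI : Type := `[0 : R, 1]%classic.

HB.instance Definition _ := Topological.on unitI.

Lemma unitI0_subproof : (0 : R) \in `[0 : R, 1]%classic.
Proof. by rewrite inE /= in_itv /= lexx ler01. Qed.

Lemma unitI1_subproof : (1 : R) \in `[0 : R, 1]%classic.
Proof. by rewrite inE /= in_itv /= lexx ler01. Qed.

Definition unitI0 : unitI := SigSub unitI0_subproof.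
Definition unitI1 : unitI := SigSub unitI1_subproof.

Lemma unitI01 : unitI0 != unitI1.
Proof. by rewrite -val_eqE /= eq_sym oner_eq0. Qed.

HB.instance Definition _ := isBiPointed.Build unitI unitI01.

Definition uval (t : unitI) : R := val t.

Lemma clampI_subproof (t : R) :
  Num.max 0 (Num.min 1 t) \in `[0 : R, 1]%classic.
Proof. by rewrite inE /= in_itv /= le_max lexx ge_max ler01 ge_min lexx. Qed.

Definition clampI (t : R) : unitI := SigSub (clampI_subproof t).

Lemma uval_ge0 t : 0 <= uval t.
Proof. by have := set_valP t; rewrite /= in_itv /= => /andP[]. Qed.

Lemma uval_le1 t : uval t <= 1.
Proof. by have := set_valP t; rewrite /= in_itv /= => /andP[]. Qed.

Lemma uval_clamp t : 0 <= t <= 1 -> uval (clampI t) = t.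
Proof. by case/andP=> t0 t1; rewrite /uval /= min_r // max_r. Qed.

Lemma uvalK : cancel uval clampI.
Proof.
move=> t; apply: val_inj; rewrite -/(uval _) uval_clamp //.
by rewrite uval_ge0 uval_le1.
Qed.

Lemma clamp_le0 t : t <= 0 -> clampI t = zero.
Proof.
by move=> t0; apply: val_inj; rewrite /= max_l // ge_min t0 orbT.
Qed.

Lemma clamp_ge1 t : 1 <= t -> clampI t = one.
Proof. by move=> t1; apply: val_inj; rewrite /= min_l // max_r. Qed.

Lemma uval0 : uval zero = 0. Proof. by []. Qed.
Lemma uval1 : uval one = 1. Proof. by []. Qed.

Lemma uval_continuous : continuous uval.
Proof. exact: initial_continuous. Qed.

Lemma clampI_continuous : continuous clampI.
Proof.
apply: continuous_comp_initial => t.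
apply: (@continuous_max _ _ (cst 0) (fun t : R => Num.min 1 t)).
  exact: cvg_cst.
by apply: (@continuous_min _ _ (cst 1) id); [exact: cvg_cst|exact: cvg_id].
Qed.

End UnitInterval.

Lemma paste_continuous (R : realType) (Y X : topologicalType) (tau : Y -> R)
    (f g : Y -> X) (c : R) :
  continuous tau -> continuous f -> continuous g ->
  (forall y, tau y = c -> f y = g y) ->
  continuous (fun y => if tau y <= c then f y else g y).
Proof.
move=> ctau cf cg fg; set h := fun y => _.
have hf : {within tau @^-1` [set t | t <= c], continuous h}.
  apply: (@subspace_eq_continuous _ _ _ f); last exact: continuous_subspaceT.
  by move=> y; rewrite inE /= => yc; rewrite /h /from_subspace /= yc.
have hg : {within tau @^-1` [set t | c <= t], continuous h}.
  apply: (@subspace_eq_continuous _ _ _ g); last exact: continuous_subspaceT.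
  move=> y; rewrite inE /= => cy; rewrite /h /from_subspace /=.
  case: ifP => // yc.
  by apply/esym/fg/le_anti; rewrite yc.
have : {within tau @^-1` [set t | t <= c] `|` tau @^-1` [set t | c <= t],
    continuous h}.
  apply: withinU_continuous hf hg.
  - by apply: preimage_closed => [y _|]; [exact: ctau|exact: closed_le].
  - by apply: preimage_closed => [y _|]; [exact: ctau|exact: closed_ge].
have -> : tau @^-1` [set t | t <= c] `|` tau @^-1` [set t | c <= t] = setT.
  apply/seteqP; split => // t _ /=.
  by case/orP: (le_total (tau t) c); [left|right].
by move=> ch; apply/continuous_subspace_setT.
Qed.

Lemma scale_continuous (R : realType) (Y : topologicalType) (a : R)
    (f : Y -> R) : continuous f -> continuous (fun y => a * f y).
Proof. by move=> cf y; apply: cvgM; [exact: cvg_cst|exact: cf]. Qed.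

Lemma shift_continuous (R : realType) (Y : topologicalType) (a : R)
    (f : Y -> R) : continuous f -> continuous (fun y => f y + a).
Proof. by move=> cf y; apply: cvgD; [exact: cf|exact: cvg_cst]. Qed.

Lemma cosub_continuous (R : realType) (Y : topologicalType) (a : R)
    (f : Y -> R) : continuous f -> continuous (fun y => a - f y).
Proof. by move=> cf y; apply: cvgB; [exact: cvg_cst|exact: cf]. Qed.

Lemma pair_continuous (Y S T : topologicalType) (f : Y -> S) (g : Y -> T) :
  continuous f -> continuous g -> continuous (fun y => (f y, g y)).
Proof.
by move=> cf cg y; apply: cvg_pair => /=; [exact: cf|exact: cg].
Qed.

Section Homotopy.
Variables (R : realType) (X : topologicalType) (x y : X).
Local Notation I := (unitI R).
Local Notation path := {path I from x to y}.

Definition homotopic (p q : path) : Prop :=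
  exists H : I * I -> X,
    [/\ continuous H, (forall t, H (t, zero) = p t),
        (forall t, H (t, one) = q t), (forall s, H (zero, s) = x)
      & (forall s, H (one, s) = y)].

Lemma homotopic_reparam (f : I -> X) (phi psi : I -> R)
    (p q : path) :
  continuous f -> continuous phi -> continuous psi ->
  phi zero = psi zero -> phi one = psi one ->
  (forall t, p t = f (clampI (phi t))) ->
  (forall t, q t = f (clampI (psi t))) -> homotopic p q.
Proof.
move=> cf cphi cpsi e0 e1 pE qE.
exists (fun ts => f (clampI
  ((1 - uval ts.2) * phi ts.1 + uval ts.2 * psi ts.1))).
have cv : continuous (fun ts : I * I => uval ts.2).
  by move=> ts; apply: (@continuous_comp _ _ _ snd);
    [exact: cvg_snd|exact: uval_continuous].
have comp1 (h : I -> R) : continuous h -> continuous (fun ts : I * I => h ts.1).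
  by move=> ch ts; apply: (@continuous_comp _ _ _ fst); [exact: cvg_fst|exact: ch].
split=> [|t|t|s|s].
- move=> ts; apply: continuous_comp; last exact: cf.
  apply: continuous_comp; last exact: clampI_continuous.
  apply: cvgD; apply: cvgM.
  + by apply: cvgB; [exact: cvg_cst|exact: cv].
  + exact: (comp1 phi).
  + exact: cv.
  + exact: (comp1 psi).
- by rewrite pE /= uval0 subr0 mul1r mul0r addr0.
- by rewrite qE /= uval1 subrr mul0r mul1r add0r.
- rewrite /= -e0 -mulrDl subrK mul1r -pE; exact: path_zero.
- rewrite /= -e1 -mulrDl subrK mul1r -pE; exact: path_one.
Qed.

Lemma homotopic_refl (p : path) : homotopic p p.
Proof.
apply: (@homotopic_reparam p (@uval R) (@uval R)) => //.
- exact: cts_fun.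
- exact: uval_continuous.
- exact: uval_continuous.
- by move=> t; rewrite uvalK.
- by move=> t; rewrite uvalK.
Qed.

Lemma snd_uval_continuous : continuous (fun ts : I * I => uval ts.2).
Proof.
move=> ts; apply: (@continuous_comp _ _ _ snd); first exact: cvg_snd.
exact: uval_continuous.
Qed.

(* Reparametrize the second variable of a map on the unit square. *)
Lemma square2_continuous (H : I * I -> X) (phi : I * I -> R) :
  continuous H -> continuous phi ->
  continuous (fun ts => H (ts.1, clampI (phi ts))).
Proof.
move=> cH cphi ts; apply: continuous_comp; last exact: cH.
apply: pair_continuous; first by move=> ?; exact: cvg_fst.
by move=> u; apply: continuous_comp; [exact: cphi|exact: clampI_continuous].
Qed.

Lemma homotopic_sym (p q : path) : homotopic p q -> homotopic q p.
Proof.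
case=> H [cH H0 H1 Hx Hy].
exists (fun ts => H (ts.1, clampI (1 - uval ts.2))); split=> [|t|t|s|s] //=.
- apply: square2_continuous => //.
  by apply: cosub_continuous; exact: snd_uval_continuous.
- by rewrite uval0 subr0 clamp_ge1.
- by rewrite uval1 subrr clamp_le0.
Qed.

Lemma homotopic_trans (p q r : path) :
  homotopic p q -> homotopic q r -> homotopic p r.
Proof.
case=> H [cH H0 H1 Hx Hy] [K [cK K0 K1 Kx Ky]].
exists (fun ts => if uval ts.2 <= 2^-1 then H (ts.1, clampI (2 * uval ts.2))
                  else K (ts.1, clampI (2 * uval ts.2 - 1))).
have c2 : continuous (fun ts : I * I => 2 * uval ts.2).
  by apply: scale_continuous; exact: snd_uval_continuous.
split=> [|t|t|s|s] /=.
- apply: paste_continuous; first exact: snd_uval_continuous.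
  + exact: square2_continuous.
  + by apply: square2_continuous => //; exact: shift_continuous.
  + move=> ts ->; rewrite divff ?pnatr_eq0// subrr clamp_ge1// clamp_le0//.
    by rewrite H1 K0.
- by rewrite uval0 invr_ge0 ler0n mulr0 clamp_le0.
- rewrite uval1 ifF; last by apply/negbTE; rewrite -ltNge; lra.
  by rewrite clamp_ge1; [exact: K1|lra].
- by case: ifP => _; [exact: Hx|exact: Kx].
- by case: ifP => _; [exact: Hy|exact: Ky].
Qed.

End Homotopy.

Section LoopConcatenation.
Variables (R : realType) (X : topologicalType) (x : X).
Local Notation I := (unitI R).
Local Notation loop := {path I from x to x}.

(* The loop [f] followed by the loop [g]. *)
Definition concat_fun (f g : I -> X) (t : I) : X :=
  if uval t <= 2^-1 then f (clampI (2 * uval t))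
  else g (clampI (2 * uval t - 1)).

Lemma concat_continuous (f g : I -> X) :
  continuous f -> continuous g -> f one = g zero ->
  continuous (concat_fun f g).
Proof.
move=> cf cg fg; have c2 : continuous (fun t : I => 2 * uval t).
  by apply: scale_continuous; exact: uval_continuous.
apply: paste_continuous; first exact: uval_continuous.
- move=> t; apply: continuous_comp; last exact: cf.
  by apply: continuous_comp; [exact: c2|exact: clampI_continuous].
- move=> t; apply: continuous_comp; last exact: cg.
  apply: continuous_comp; last exact: clampI_continuous.
  exact: shift_continuous.
- move=> t ->; rewrite divff ?pnatr_eq0// subrr clamp_ge1// clamp_le0//.
Qed.

Lemma concat_zero (f g : I -> X) : concat_fun f g zero = f zero.
Proof. by rewrite /concat_fun uval0 invr_ge0 ler0n mulr0 clamp_le0. Qed.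

Lemma concat_one (f g : I -> X) : concat_fun f g one = g one.
Proof.
rewrite /concat_fun uval1 ifF; last by apply/negbTE; rewrite -ltNge; lra.
by rewrite clamp_ge1 //; lra.
Qed.

Section concat.
Variables p q : loop.

Let pq : p one = q zero.
Proof. by rewrite path_one path_zero. Qed.
Let pq0 : concat_fun p q zero = x.
Proof. by rewrite concat_zero path_zero. Qed.
Let pq1 : concat_fun p q one = x.
Proof. by rewrite concat_one path_one. Qed.

Definition concat : loop :=
  mk_path (concat_continuous (@cts_fun _ _ p) (@cts_fun _ _ q) pq) pq0 pq1.

Lemma concatE t : concat t = concat_fun p q t. Proof. by []. Qed.

End concat.

Section rev_loop.
Variable p : loop.

Let revp (t : I) : X := p (clampI (1 - uval t)).
Let revp_continuous : continuous revp.
Proof.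
move=> t.
apply: (@continuous_comp _ _ _ (fun t : I => clampI (1 - uval t)) p);
  last by exact: cts_fun.
apply: continuous_comp; last exact: clampI_continuous.
by apply: cosub_continuous; exact: uval_continuous.
Qed.
Let revp0 : revp zero = x.
Proof. by rewrite /revp uval0 subr0 clamp_ge1 // path_one. Qed.
Let revp1 : revp one = x.
Proof. by rewrite /revp uval1 subrr clamp_le0 // path_zero. Qed.

Definition rev_loop : loop := mk_path revp_continuous revp0 revp1.

Lemma rev_loopE t : rev_loop t = p (clampI (1 - uval t)). Proof. by []. Qed.

End rev_loop.

Definition cst_loop : loop := cst x.

Local Notation homotopic := (@homotopic R X x x).

Lemma homotopic_concat (p p' q q' : loop) :
  homotopic p p' -> homotopic q q' -> homotopic (concat p q) (concat p' q').
Proof.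
case=> H [cH H0 H1 Hx Hy] [K [cK K0 K1 Kx Ky]].
exists (fun ts => if uval ts.1 <= 2^-1 then H (clampI (2 * uval ts.1), ts.2)
                  else K (clampI (2 * uval ts.1 - 1), ts.2)).
have c1 : continuous (fun ts : I * I => uval ts.1).
  move=> ts; apply: (@continuous_comp _ _ _ fst); first exact: cvg_fst.
  exact: uval_continuous.
have c2 : continuous (fun ts : I * I => 2 * uval ts.1).
  exact: scale_continuous.
split=> [|t|t|s|s] /=.
- apply: paste_continuous => //.
  + move=> ts; apply: continuous_comp; last exact: cH.
    apply: pair_continuous; last by move=> ?; exact: cvg_snd.
    by move=> u; apply: continuous_comp; [exact: c2|exact: clampI_continuous].
  + move=> ts; apply: continuous_comp; last exact: cK.
    apply: pair_continuous; last by move=> ?; exact: cvg_snd.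
    move=> u; apply: continuous_comp; last exact: clampI_continuous.
    exact: shift_continuous.
  + move=> ts ->; rewrite divff ?pnatr_eq0// subrr clamp_ge1// clamp_le0//.
    by rewrite Hy Kx.
- by rewrite concatE /concat_fun H0 K0.
- by rewrite concatE /concat_fun H1 K1.
- by rewrite uval0 invr_ge0 ler0n mulr0 clamp_le0.
- rewrite uval1 ifF; last by apply/negbTE; rewrite -ltNge; lra.
  by rewrite clamp_ge1; [exact: Ky|lra].
Qed.

Lemma homotopic_rev (p q : loop) :
  homotopic p q -> homotopic (rev_loop p) (rev_loop q).
Proof.
case=> H [cH H0 H1 Hx Hy].
exists (fun ts => H (clampI (1 - uval ts.1), ts.2)); split=> [|t|t|s|s] //=.
- move=> ts; apply: continuous_comp; last exact: cH.
  apply: pair_continuous; last by move=> ?; exact: cvg_snd.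
  move=> u; apply: continuous_comp; last exact: clampI_continuous.
  apply: cosub_continuous => {}u; apply: (@continuous_comp _ _ _ fst); first exact: cvg_fst.
  exact: uval_continuous.
- by rewrite H0 rev_loopE.
- by rewrite H1 rev_loopE.
- by rewrite uval0 subr0 clamp_ge1.
- by rewrite uval1 subrr clamp_le0.
Qed.

Let cmin (f g : I -> R) :
  continuous f -> continuous g -> continuous (fun t => Num.min (f t) (g t)).
Proof. by move=> cf cg t; apply: continuous_min; [exact: cf|exact: cg]. Qed.

Let cmax (f g : I -> R) :
  continuous f -> continuous g -> continuous (fun t => Num.max (f t) (g t)).
Proof. by move=> cf cg t; apply: continuous_max; [exact: cf|exact: cg]. Qed.

Let caff (a b : R) : continuous (fun t : I => a * uval t + b).
Proof.
by apply: shift_continuous; apply: scale_continuous; exact: uval_continuous.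
Qed.

Lemma homotopic_concatA (p q r : loop) :
  homotopic (concat p (concat q r)) (concat (concat p q) r).
Proof.
apply/homotopic_sym.
pose phi (t : I) := Num.min (2 * uval t + 0)
  (Num.min (1 * uval t + 4^-1) (2^-1 * uval t + 2^-1)).
have phiE t : phi t = if uval t <= 4^-1 then 2 * uval t else
    if uval t <= 2^-1 then uval t + 4^-1 else 2^-1 * uval t + 2^-1.
  rewrite /phi; case: (lerP (uval t) 4^-1) => t4.
    by rewrite min_l ?addr0 // le_min; apply/andP; split; lra.
  case: (lerP (uval t) 2^-1) => t2.
    by rewrite (@min_l _ _ (1 * _ + _)) ?min_r; lra.
  by rewrite (@min_r _ _ (1 * _ + _)) ?min_r //; lra.
apply: (@homotopic_reparam _ _ _ _ (concat p (concat q r)) phi (@uval R)).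
- exact: cts_fun.
- by apply: cmin; [exact: caff|apply: cmin; exact: caff].
- exact: uval_continuous.
- by rewrite phiE uval0 ifT ?mulr0 //; lra.
- by rewrite phiE uval1 !ifF; [lra|apply/negbTE; rewrite -ltNge; lra..].
- move=> t; have t0 := uval_ge0 t; have t1 := uval_le1 t.
  rewrite !concatE /concat_fun !concatE /concat_fun phiE.
  case: (lerP (uval t) 4^-1) => t4.
    rewrite (@uval_clamp _ (2 * uval t)); last by lra.
    by rewrite !ifT //; lra.
  case: (lerP (uval t) 2^-1) => t2.
    rewrite (@uval_clamp _ (2 * uval t)); last by lra.
    rewrite (@uval_clamp _ (uval t + 4^-1)); last by lra.
    rewrite ifF; last by apply/negbTE; rewrite -ltNge; lra.
    rewrite ifF; last by apply/negbTE; rewrite -ltNge; lra.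
    rewrite uval_clamp; last by lra.
    by rewrite ifT; [congr (q (clampI _))|]; lra.
  rewrite (@uval_clamp _ (2^-1 * uval t + 2^-1)); last by lra.
  rewrite ifF; last by apply/negbTE; rewrite -ltNge; lra.
  have -> : 2 * (2^-1 * uval t + 2^-1) - 1 = uval t by lra.
  by rewrite uvalK ifF //; apply/negbTE; rewrite -ltNge.
- by move=> t; rewrite uvalK.
Qed.

Lemma homotopic_concat1 (p : loop) : homotopic (concat cst_loop p) p.
Proof.
apply: (@homotopic_reparam _ _ _ _ p
  (fun t => Num.max 0 (2 * uval t + -1)) (@uval R)).
- exact: cts_fun.
- by apply: cmax; [exact: cst_continuous|exact: caff].
- exact: uval_continuous.
- by rewrite uval0; case: ltP => ?; lra.
- by rewrite uval1; case: ltP => ?; lra.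
- move=> t; rewrite concatE /concat_fun; case: ifPn => t2.
    by rewrite max_l ?(@clamp_le0 _ 0) ?path_zero //; lra.
  by move: t2; rewrite -ltNge => t2; rewrite max_r //; lra.
- by move=> t; rewrite uvalK.
Qed.

Lemma homotopic_concatr1 (p : loop) : homotopic (concat p cst_loop) p.
Proof.
apply: (@homotopic_reparam _ _ _ _ p
  (fun t => Num.min 1 (2 * uval t + 0)) (@uval R)).
- exact: cts_fun.
- by apply: cmin; [exact: cst_continuous|exact: caff].
- exact: uval_continuous.
- by rewrite uval0; case: ltP => ?; lra.
- by rewrite uval1; case: ltP => ?; lra.
- move=> t; rewrite concatE /concat_fun addr0; case: ifPn => t2.
    by rewrite min_r //; lra.
  move: t2; rewrite -ltNge => t2.
  by rewrite min_l ?(@clamp_ge1 _ 1) ?path_one //; lra.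
- by move=> t; rewrite uvalK.
Qed.

Lemma homotopic_concatrV (p : loop) :
  homotopic (concat p (rev_loop p)) cst_loop.
Proof.
apply: (@homotopic_reparam _ _ _ _ p
  (fun t => Num.min (2 * uval t + 0) (- 2 * uval t + 2)) (cst 0)).
- exact: cts_fun.
- by apply: cmin; exact: caff.
- exact: cst_continuous.
- rewrite uval0 [RHS](_ : _ = 0 :> R) //; case: ltP => ?; lra.
- rewrite uval1 [RHS](_ : _ = 0 :> R) //; case: ltP => ?; lra.
- move=> t; have t1 := uval_le1 t.
  rewrite concatE /concat_fun rev_loopE addr0; case: ifPn => t2.
    by rewrite min_l //; lra.
  move: t2; rewrite -ltNge => t2; rewrite uval_clamp; last by lra.
  by rewrite min_r; [congr (p (clampI _))|]; lra.
- by move=> t; rewrite clamp_le0 // path_zero.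
Qed.

Lemma rev_loopK (p : loop) : rev_loop (rev_loop p) = p.
Proof.
apply/path_eqP => t; rewrite !rev_loopE uval_clamp.
  by rewrite subKr uvalK.
by have := uval_ge0 t; have := uval_le1 t; lra.
Qed.

Lemma homotopic_concatV (p : loop) :
  homotopic (concat (rev_loop p) p) cst_loop.
Proof. by rewrite -{2}(rev_loopK p); exact: homotopic_concatrV. Qed.

End LoopConcatenation.

Section FundamentalGroup.
Variables (R : realType) (X : topologicalType) (x : X).
Local Notation loop := {path unitI R from x to x}.

Definition homotopicb (p q : loop) : bool := `[< homotopic p q >].

Lemma homotopicb_refl : reflexive homotopicb.
Proof. by move=> p; apply/asboolP; exact: homotopic_refl. Qed.

Lemma homotopicb_sym : symmetric homotopicb.
Proof. by move=> p q; apply/asboolP/asboolP; exact: homotopic_sym. Qed.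

Lemma homotopicb_trans : transitive homotopicb.
Proof.
move=> q p r /asboolP pq /asboolP qr; apply/asboolP.
exact: homotopic_trans pq qr.
Qed.

Definition homotopy_rel :=
  EquivRel homotopicb homotopicb_refl homotopicb_sym homotopicb_trans.

Definition pi1 : Type := {eq_quot homotopy_rel}.

HB.instance Definition _ := Choice.on pi1.
HB.instance Definition _ := EqQuotient.on pi1.

Lemma pi1P (p q : loop) : \pi_pi1 p = \pi_pi1 q <-> homotopic p q.
Proof.
by split=> [/eqmodP/asboolP//|pq]; apply/eqmodP/asboolP.
Qed.

Lemma pi1_repr (p : loop) : homotopic (repr (\pi_pi1 p)) p.
Proof. by apply/pi1P; rewrite reprK. Qed.

Definition pi1_one : pi1 := \pi_pi1 (cst_loop R x).
Definition pi1_mul (a b : pi1) : pi1 := \pi_pi1 (concat (repr a) (repr b)).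
Definition pi1_inv (a : pi1) : pi1 := \pi_pi1 (rev_loop (repr a)).

Lemma pi1_mulE (p q : loop) :
  pi1_mul (\pi_pi1 p) (\pi_pi1 q) = \pi_pi1 (concat p q).
Proof. by apply/pi1P; apply: homotopic_concat; exact: pi1_repr. Qed.

Lemma pi1_invE (p : loop) : pi1_inv (\pi_pi1 p) = \pi_pi1 (rev_loop p).
Proof. by apply/pi1P; apply: homotopic_rev; exact: pi1_repr. Qed.

Lemma pi1_mulA : associative pi1_mul.
Proof.
elim/quotP=> p _; elim/quotP=> q _; elim/quotP=> r _.
rewrite (pi1_mulE q r) (pi1_mulE p q) !pi1_mulE.
apply/pi1P; exact: homotopic_concatA.
Qed.

Lemma pi1_mul1 : left_id pi1_one pi1_mul.
Proof.
by elim/quotP=> p _; rewrite pi1_mulE; apply/pi1P; exact: homotopic_concat1.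
Qed.

Lemma pi1_mulr1 : right_id pi1_one pi1_mul.
Proof.
by elim/quotP=> p _; rewrite pi1_mulE; apply/pi1P; exact: homotopic_concatr1.
Qed.

Lemma pi1_mulV : left_inverse pi1_one pi1_inv pi1_mul.
Proof.
elim/quotP=> p _; rewrite pi1_invE pi1_mulE; apply/pi1P.
exact: homotopic_concatV.
Qed.

Lemma pi1_mulrV : right_inverse pi1_one pi1_inv pi1_mul.
Proof.
elim/quotP=> p _; rewrite pi1_invE pi1_mulE; apply/pi1P.
exact: homotopic_concatrV.
Qed.

HB.instance Definition _ := isGroup.Build pi1
  pi1_mulA pi1_mul1 pi1_mulr1 pi1_mulV pi1_mulrV.

End FundamentalGroup.

Arguments pi1 R {X} x.

(** * The complex projective plane *)

Section ProjectivePlane.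
Variable R : realType.

(* As a bare type [R[i]] carries no topology; seen as a numClosedFieldType it
   gets the topology of its norm, and matrices over it get the product one. *)
Definition Cplx : numClosedFieldType := R[i].

Definition nonzero_vector : set 'rV[Cplx]_3 := [set v | v != 0].

Definition proportional (v w : nonzero_vector) : bool :=
  `[< exists2 c : Cplx, c != 0 & val w = c *: val v >].

Lemma proportional_refl : reflexive proportional.
Proof.
by move=> v; apply/asboolP; exists 1; rewrite ?oner_eq0 // scale1r.
Qed.

Lemma proportional_sym : symmetric proportional.
Proof.
suff h v w : proportional v w -> proportional w v.
  by move=> v w; apply/idP/idP; exact: h.
case/asboolP=> c c0 wE; apply/asboolP; exists c^-1; first by rewrite invr_eq0.
by rewrite wE scalerA mulVf // scale1r.
Qed.

Lemma proportional_trans : transitive proportional.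
Proof.
move=> v u w /asboolP[c c0 vE] /asboolP[d d0 wE]; apply/asboolP.
by exists (d * c); [rewrite mulf_neq0|rewrite wE vE scalerA].
Qed.

Definition proportional_rel :=
  EquivRel proportional proportional_refl proportional_sym proportional_trans.

Definition CP2 : topologicalType :=
  quotient_topology {eq_quot proportional_rel}.

(* The line of equation [a 0 0 * z0 + a 1 0 * z1 + a 2 0 * z2 = 0]; by [lineE]
   the choice of homogeneous coordinates is immaterial. *)
Definition line (a : 'cV[Cplx]_3) : set CP2 :=
  [set p | val (repr p : nonzero_vector) *m a = 0].

Lemma lineE a (v : nonzero_vector) : line a (\pi_CP2 v) <-> val v *m a = 0.
Proof.
have /eqmodP/asboolP[c c0 vE] :
  \pi_{eq_quot proportional_rel} (repr (\pi_CP2 v)) =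
  \pi_{eq_quot proportional_rel} v by exact: (reprK (\pi_CP2 v)).
rewrite vE -scalemxAl /line /=; split=> [->|/eqP]; first by rewrite scaler0.
by rewrite scaler_eq0 (negPf c0) /= => /eqP.
Qed.

Definition projective_line (l : set CP2) : Prop :=
  exists2 a : 'cV[Cplx]_3, a != 0 & l = line a.

Definition real_line (l : set CP2) : Prop :=
  exists2 a : 'cV[R]_3, a != 0 &
    l = line (map_mx (fun t : R => t%:C%C : Cplx) a).

(* The affine plane whose line at infinity is [linf], kept inside [CP2]. *)
Definition C2 (linf : set CP2) : set CP2 := ~` linf.

End ProjectivePlane.

Section LineArrangement.
Variable R : realType.
Implicit Types (L : set (set (CP2 R))) (p q : CP2 R).

Definition real_line_arrangement L : Prop :=
  finite_set L /\ L `<=` @real_line R.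

Definition union_lines L : set (CP2 R) := \bigcup_(l in L) l.

Definition intersection_points L : set (CP2 R) :=
  [set p | exists l m, [/\ L l, L m, l <> m, l p & m p]].

(* The points lying on at least three lines of [L]. *)
Definition multiple_points L : set (CP2 R) :=
  [set p | `I_3 #<= [set l | L l /\ l p]].

Definition adjacent L p q : Prop :=
  [/\ multiple_points L p, multiple_points L q
    & exists l, [/\ L l, l p & l q]].

Definition multiple_equiv L p q : Prop :=
  exists2 s : seq (CP2 R), path (fun u v => `[< adjacent L u v >]) p s &
    q = last p s.

Definition multiple_class L : set (set (CP2 R)) :=
  [set C | exists2 p, multiple_points L p &
             C = [set q | multiple_points L q /\ multiple_equiv L p q]].

End LineArrangement.

(* Main.v *)
(* One multiple point p is enough, and neither the reality of the lines nor the
   classes of multiple points matter.  Three lines through p are members of a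
   pencil, and the projection from p maps the complement of any finite family of
   lines containing these three to C minus {0, 1}.  A line through the base point
   that avoids p is a section of this projection off finitely many points, so two
   loops of C minus {0, 1} around 0 and around 1, in general position, lift to
   the complement.  The free group on two letters defines a flat bundle over
   C minus {0, 1}, trivialised off two of the three real intervals cut out by 0
   and 1; its pullback has holonomy conjugate to the two generators along the two
   loops, so they generate a free group.  The affine case follows by adding the
   line at infinity to the family. *)

From HB Require Import structures.
From mathcomp Require Import all_boot all_order all_algebra generic_quotient.
From mathcomp Require Import ring lra.
From mathcomp Require Import all_classical all_reals topology normedtype homotopy.
From mathcomp Require Import complex.
Require Import Defs.

Set Implicit Arguments.
Unset Strict Implicit.
Unset Printing Implicit Defensive.

Import Order.TTheory GRing.Theory Num.Theory.
Import numFieldNormedType.Exports.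

Local Open Scope classical_set_scope.
Local Open Scope ring_scope.
Local Open Scope quotient_scope.

(** * Induction along a compact interval *)

(** At the supremum of the points [x] with [P a x], the local hypothesis leads from a point of this
    set just below to points beyond, so the supremum is [b]. This does the work of a Lebesgue number
    for paths and squares. *)
Lemma interval_induction (R : realType) (P : R -> R -> Prop) (a b : R) :
  a <= b ->
  (forall x y z, x <= y -> y <= z -> P x y -> P y z -> P x z) ->
  (forall x, a <= x <= b -> exists2 e : R, 0 < e &
     forall u v, x - e < u -> u <= x -> x <= v -> v < x + e ->
       a <= u -> v <= b -> P u v) ->
  P a b.
Proof.
move=> ab Ptrans Ploc.
pose S := [set x | a <= x <= b /\ P a x].
have Sa : S a.
  split; first by rewrite lexx.
  have [|e e0 H] := Ploc a; first by rewrite lexx.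
  by apply: H => //; lra.
have hS : has_sup S.
  by split; [exists a|exists b => x [/andP[]]].
have as_ : a <= sup S by exact: ub_le_sup hS.2 _ Sa.
have sb : sup S <= b by apply: ge_sup; [exists a|move=> x [/andP[]]].
have [|e e0 H] := Ploc (sup S); first by rewrite as_.
have [x [/andP[ax xb] Pax] xs] := sup_adherent e0 hS.
have xS : x <= sup S by apply: ub_le_sup hS.2 _ _; split; rewrite ?ax.
have PaV v : sup S <= v -> v < sup S + e -> v <= b -> P a v.
  move=> sv ve vb; apply: (Ptrans _ x) => //; first by lra.
  by apply: H.
have [sb'|bs] := ltP (sup S) b; last first.
  have {1}-> : b = sup S by lra.
  by apply: PaV; lra.
pose v := Num.min b (sup S + e / 2).
have vb : v <= b by rewrite /v ge_min lexx.
have sv : sup S < v by rewrite /v lt_min sb'; lra.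
have ve : v <= sup S + e / 2 by rewrite /v ge_min lexx orbT.
have : v <= sup S.
  by apply: (ub_le_sup hS.2); split; [lra|apply: PaV; lra].
by lra.
Qed.

(** * Flat bundles *)

(* The cocycle of a principal [G]-bundle with discrete structure group, in the
   form of arbitrary functions on charts with locally constant quotients. *)
Record flat_atlas (X : topologicalType) (G : groupType) := FlatAtlas {
  atlas_index : Type;
  chart : atlas_index -> set X;
  triv : atlas_index -> X -> G;
  chart_open : forall k, open (chart k);
  chart_cover : forall x, exists k, chart k x;
  triv_compat : forall i j x, chart i x -> chart j x ->
    \forall y \near x, ((triv i y)^-1 * triv j y = (triv i x)^-1 * triv j x)%g
}.
Arguments chart {X G} f k.
Arguments triv {X G} f k.

Section FlatSections.
Variables (X : topologicalType) (G : groupType) (F : flat_atlas X G).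

(* [a] is the coordinate of a locally constant lift of [h] to the bundle. *)
Definition flat_on (T : topologicalType) (A : set T) (h : T -> X) (a : T -> G) :=
  forall t0, A t0 -> forall k, chart F k (h t0) -> \forall t \near t0,
    A t -> (a t * triv F k (h t) = a t0 * triv F k (h t0))%g.

Section Generic.
Variable T : topologicalType.
Implicit Types (A B : set T) (h : T -> X) (a : T -> G).

(** The quotient of two trivialisations is locally constant along [h], so it suffices to test one
    chart at [t0]. *)
Lemma flat_on_chart A h a t0 i j : continuous h -> A t0 ->
  chart F i (h t0) -> chart F j (h t0) ->
  (\forall t \near t0, A t ->
     (a t * triv F i (h t) = a t0 * triv F i (h t0))%g) ->
  \forall t \near t0, A t ->
     (a t * triv F j (h t) = a t0 * triv F j (h t0))%g.
Proof.
move=> ch At0 Ui Uj ai.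
have cij := ch t0 _ (triv_compat Ui Uj).
apply: filterS2 ai cij => t ai cij At.
by rewrite -[triv F j (h t)](mulVKg (triv F i (h t))) cij mulgA ai // -mulgA
  mulVKg.
Qed.

Lemma flat_onS A B h a : A `<=` B -> flat_on B h a -> flat_on A h a.
Proof.
move=> AB Ba t0 /AB Bt0 k Uk.
by apply: filterS (Ba t0 Bt0 k Uk) => t Bt /AB.
Qed.

Lemma flat_on_mull A h a g : flat_on A h a -> flat_on A h (fun t => g * a t)%g.
Proof.
move=> Aa t0 At0 k Uk; apply: filterS (Aa t0 At0 k Uk) => t E At.
by rewrite -!mulgA E.
Qed.

Lemma eq_flat_on A h h' a a' : {in A, h =1 h'} -> {in A, a =1 a'} ->
  flat_on A h a -> flat_on A h' a'.
Proof.
move=> hh aa Aa t0 At0 k Uk.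
have At0' : t0 \in A by rewrite inE.
move: Uk; rewrite -hh // => Uk.
apply: filterS (Aa t0 At0 k Uk) => t E At.
by rewrite -hh -?aa ?inE // E.
Qed.

(** In the chart [k] the product of the coordinate and the trivialisation is constantly 1; other
    charts follow by [flat_on_chart]. *)
Lemma flat_on_triv A h k : continuous h -> A `<=` h @^-1` chart F k ->
  flat_on A h (fun t => (triv F k (h t))^-1)%g.
Proof.
move=> ch Ak t0 At0 j Uj; apply: (@flat_on_chart _ _ _ _ k) => //; first exact: Ak.
by near=> t => _; rewrite !mulVg.
Unshelve. all: by end_near.
Qed.

(** Near a point outside a closed piece the condition on that piece is vacuous, so each point is
    checked only on the pieces containing it. *)
Lemma flat_on_paste A B h a b : closed A -> closed B ->
  {in A `&` B, a =1 b} -> flat_on A h a -> flat_on B h b ->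
  flat_on (A `|` B) h (fun t => if `[< A t >] then a t else b t).
Proof.
move=> cA cB ab Aa Bb; set d := fun t => _.
have dA t : A t -> d t = a t by move=> At; rewrite /d asboolT.
have dB t : B t -> d t = b t.
  by move=> Bt; rewrite /d; case: asboolP => // At; apply: ab; rewrite inE.
have near_piece (C : set T) (e : T -> G) t0 k : closed C -> flat_on C h e ->
    (forall t, C t -> d t = e t) -> chart F k (h t0) ->
    \forall t \near t0, C t ->
      (d t * triv F k (h t) = d t0 * triv F k (h t0))%g.
  move=> cC Ce dC Uk; have [Ct0|nCt0] := pselect (C t0).
    by apply: filterS (Ce t0 Ct0 k Uk) => t E Ct; rewrite !dC // E.
  have : nbhs t0 (~` C) by apply: open_nbhs_nbhs; split=> //; exact: closed_openC.
  by apply: filterS => t.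
move=> t0 _ k Uk.
have := near_piece A a t0 k cA Aa dA Uk.
have := near_piece B b t0 k cB Bb dB Uk.
by apply: filterS2 => t EB EA [/EA|/EB].
Qed.

End Generic.

Lemma flat_on_comp (S T : topologicalType) (phi : S -> T) (A : set T)
    (h : T -> X) (a : T -> G) : continuous phi ->
  flat_on A h a -> flat_on (phi @^-1` A) (h \o phi) (a \o phi).
Proof.
move=> cphi Aa s0 As0 k Uk.
exact: cphi s0 _ (Aa _ As0 k Uk).
Qed.

(** * Lifts over intervals and squares *)

Section Real.
Variable R : realType.

(** In a chart both lifts change by the same right factor, so the quotient of [a] by [b] is locally
    constant, and interval induction makes its end values equal. *)
Lemma flat_on_uniq (u v : R) (h : R -> X) (a b : R -> G) : u <= v ->
  flat_on [set t | u <= t <= v] h a -> flat_on [set t | u <= t <= v] h b ->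
  (a u * (b u)^-1 = a v * (b v)^-1)%g.
Proof.
move=> uv ha hb.
apply: (@interval_induction _
  (fun x y => (a x * (b x)^-1 = a y * (b y)^-1)%g) u v) => //.
  by move=> x y z _ _ ->.
move=> x uxv; have [k Uk] := chart_cover F (h x).
have /nbhs_ballP[e /= e0 He] : \forall t \near x,
    u <= t <= v -> (a t * (b t)^-1 = a x * (b x)^-1)%g.
  apply: filterS2 (ha x uxv k Uk) (hb x uxv k Uk) => t Ea Eb ut.
  have eqV (g : R -> G) : (g t * triv F k (h t) = g x * triv F k (h x))%g ->
      (g t = g x * (triv F k (h x) / triv F k (h t)))%g.
    by rewrite mulgA => <-; rewrite mulgK.
  by rewrite (eqV a) ?Ea // (eqV b) ?Eb // invgM mulgA mulgK.
exists e => // u' v' ? ? ? ? ? ?.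
move: uxv => /andP[? ?].
rewrite !He //=; try by rewrite /ball /= ltr_norml; apply/andP; split; lra.
all: by apply/andP; split; lra.
Qed.

(** The overlap is the image of a path, along which the two lifts differ by a constant left factor;
    translating [b] by this factor makes them agree there. *)
Lemma flat_on_glue (T : topologicalType) (A B : set T) (h : T -> X)
    (phi : R -> T) (u v : R) : closed A -> closed B -> continuous phi ->
  u <= v -> (forall t, u <= t <= v -> (A `&` B) (phi t)) ->
  (forall x, (A `&` B) x -> exists2 t, u <= t <= v & phi t = x) ->
  (exists a, flat_on A h a) -> (exists b, flat_on B h b) ->
  exists d, flat_on (A `|` B) h d.
Proof.
move=> cA cB cphi uv phiAB ABphi [a ha] [b hb].
pose g := (a (phi u) * (b (phi u))^-1)%g.
exists (fun t => if `[< A t >] then a t else g * b t)%g.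
apply: flat_on_paste => //; last exact: flat_on_mull.
move=> x; rewrite inE => /ABphi[t /andP[ut tv] <-].
rewrite /g.
have restr (C : set T) e : flat_on C h e -> A `&` B `<=` C ->
    flat_on [set s | u <= s <= t] (h \o phi) (e \o phi).
  move=> Ce ABC; apply: flat_onS (flat_on_comp cphi Ce) => s /andP[us st].
  by apply/ABC/phiAB; rewrite us (le_trans st tv).
have := flat_on_uniq ut (restr _ _ ha (@subIsetl _ _ _))
  (restr _ _ hb (@subIsetr _ _ _)).
by move=> /= ->; rewrite mulgVK.
Qed.

Definition rect (u v s t : R) : set (R * R) :=
  [set x | u <= x.1 <= v /\ s <= x.2 <= t].

Lemma closed_rect u v s t : closed (rect u v s t).
Proof.
have -> : rect u v s t =
    (fst @^-1` [set x | u <= x] `&` fst @^-1` [set x | x <= v]) `&`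
    (snd @^-1` [set x | s <= x] `&` snd @^-1` [set x | x <= t]).
  by apply/seteqP; split=> x /=; [move=> [/andP[? ?] /andP[? ?]]|
    move=> [[? ?] [? ?]]; split; apply/andP].
have cf : continuous (@fst R R) by move=> x; exact: cvg_fst.
have cs : continuous (@snd R R) by move=> x; exact: cvg_snd.
by apply: closedI; apply: closedI; (apply: preimage_closed;
  [by move=> x _; first [exact: cf|exact: cs]|]);
  first [exact: closed_ge|exact: closed_le].
Qed.

(** Two nested interval inductions: the outer one stacks strips along horizontal edges, the inner
    one builds a thin strip around height [s0] from boxes glued along vertical edges. *)
Lemma flat_on_square (H : R * R -> X) : continuous H ->
  exists a, flat_on (rect 0 1 0 1) H a.
Proof.
move=> cH.
apply: (@interval_induction _ (fun s s' => exists a, flat_on (rect 0 1 s s') H a)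
  0 1) => // [s1 s2 s3 s12 s23 H12 H23|s0 _].
  have -> : rect 0 1 s1 s3 = rect 0 1 s1 s2 `|` rect 0 1 s2 s3.
    apply/seteqP; split=> [[x y] [/= hx /andP[y1 y3]]|
        [x y] [] [/= hx /andP[y1 y2]]].
    - by have [y2|/ltW y2] := leP y s2; [left|right]; split=> //=; apply/andP.
    - by split=> //=; apply/andP; split=> //; exact: le_trans s23.
    - by split=> //=; apply/andP; split=> //; exact: le_trans y1.
  apply: (@flat_on_glue _ _ _ _ (fun t => (t, s2)) 0 1) => //.
  - exact: closed_rect.
  - exact: closed_rect.
  - apply: pair_continuous => x; [exact: cvg_id|exact: cvg_cst].
  - by move=> t t01; split; split=> //=; apply/andP.
  - move=> [x y] [[/= hx /andP[_ ?]] [_ /andP[/= ? _]]]; exists x => //.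
    by congr pair; apply/le_anti/andP.
suff [e e0 [a ha]] : exists2 e : R, 0 < e &
    exists a, flat_on (rect 0 1 (s0 - e) (s0 + e)) H a.
  exists e => // u v ? ? ? ? ? ?; exists a.
  apply: flat_onS ha => x [/= hx /andP[? ?]]; split=> //=.
  by apply/andP; split; lra.
apply: (@interval_induction _ (fun t t' => exists2 e : R, 0 < e &
    exists a, flat_on (rect t t' (s0 - e) (s0 + e)) H a) 0 1) => //.
  move=> t1 t2 t3 t12 t23 [e e0 [a ha]] [e' e'0 [a' ha']].
  (* The two boxes are cut down to a common half-height before they are glued. *)
  pose d := Num.min e e'.
  have de : d <= e by rewrite ge_min lexx.
  have de' : d <= e' by rewrite ge_min lexx orbT.
  have d0 : 0 < d by rewrite lt_min e0.
  exists d => //.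
  have -> : rect t1 t3 (s0 - d) (s0 + d) =
      rect t1 t2 (s0 - d) (s0 + d) `|` rect t2 t3 (s0 - d) (s0 + d).
    apply/seteqP; split=> [[x y] [/= /andP[y1 y3] hx]|
        [x y] [] [/= /andP[y1 y2] hx]].
    - by have [y2|/ltW y2] := leP x t2; [left|right]; split=> //=; apply/andP.
    - by split=> //=; apply/andP; split=> //; exact: le_trans t23.
    - by split=> //=; apply/andP; split=> //; exact: le_trans y1.
  apply: (@flat_on_glue _ _ _ _ (fun s => (t2, s)) (s0 - d) (s0 + d)) => //.
  - exact: closed_rect.
  - exact: closed_rect.
  - apply: pair_continuous => x; [exact: cvg_cst|exact: cvg_id].
  - by lra.
  - by move=> t t01; split; split=> //=; apply/andP.
  - move=> [x y] [[/= /andP[_ ?] hy] [/= /andP[/= ? _] _]]; exists y => //.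
    by congr pair; apply/le_anti/andP.
  - exists a; apply: flat_onS ha => x [/= hx /andP[? ?]]; split=> //=.
    by apply/andP; split; lra.
  - exists a'; apply: flat_onS ha' => x [/= hx /andP[? ?]]; split=> //=.
    by apply/andP; split; lra.
(* A small box around [(t0, s0)] is mapped into a single chart, where the inverse of the
   trivialisation is a lift. *)
move=> t0 _; have [k Uk] := chart_cover F (H (t0, s0)).
have /nbhs_ballP[e /= e0 He] : nbhs (t0, s0) (H @^-1` chart F k).
  apply: cH; apply: open_nbhs_nbhs; split=> //; exact: chart_open.
exists e => // u v ? ? ? ? _ _.
exists (e / 2); first by lra.
exists (fun x => (triv F k (H x))^-1)%g.
apply: flat_on_triv => // -[x y] [/= /andP[? ?] /andP[? ?]].
by apply: He; split; rewrite /ball /= ltr_norml; apply/andP; split; lra.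
Qed.

End Real.

End FlatSections.

(** * Holonomy *)

Section FreeGroupEvaluation.
Variables (A : choiceType) (G : groupType).

Definition eval_letter (f : A -> G) (x : letter A) : G :=
  if x.2 then f x.1 else (f x.1)^-1%g.

Definition eval_word (f : A -> G) (w : seq (letter A)) : G :=
  (\prod_(x <- w) eval_letter f x)%g.

Lemma eval_letterV f x : eval_letter f (letterV x) = (eval_letter f x)^-1%g.
Proof. by rewrite /eval_letter /=; case: x.2; rewrite //= invgK. Qed.

Lemma eval_word_cons f x w :
  eval_word f (x :: w) = (eval_letter f x * eval_word f w)%g.
Proof. exact: big_cons. Qed.

Lemma eval_word_reduced_cons f x w :
  eval_word f (reduced_cons x w) = (eval_letter f x * eval_word f w)%g.
Proof.
case: w => [|y w] /=; first exact: eval_word_cons.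
have [->|_] := eqVneq x (letterV y); rewrite !eval_word_cons //.
by rewrite eval_letterV mulKg.
Qed.

Lemma eval_word_reduced_cat f u v :
  eval_word f (reduced_cat u v) = (eval_word f u * eval_word f v)%g.
Proof.
elim: u => [|x u IHu] /=; first by rewrite /eval_word big_nil mul1g.
by rewrite eval_word_reduced_cons IHu eval_word_cons mulgA.
Qed.

Definition free_eval (f : A -> G) (w : free_group A) : G := eval_word f w.

Lemma free_evalM f : {morph free_eval f : u v / (u * v)%g}.
Proof. by move=> u v; exact: eval_word_reduced_cat. Qed.

HB.instance Definition _ f :=
  isMultiplicative.Build (free_group A) G (free_eval f) (free_evalM f).

Lemma free_evalJ f g w : free_eval (fun i => f i ^ g)%g w = (free_eval f w ^ g)%g.
Proof.
rewrite /free_eval /eval_word conjg_prod; apply: eq_bigr => x _.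
by rewrite /eval_letter; case: x.2; rewrite ?conjVg.
Qed.

End FreeGroupEvaluation.

Definition free_gen (A : choiceType) (i : A) : free_group A :=
  @FreeGroup A [:: (i, true)] isT.

(** No letter of a reduced word cancels against its successor, so multiplying out the generators
    rebuilds the word. This is what recovers a word from its holonomy. *)
Lemma free_eval_gen (A : choiceType) (w : free_group A) :
  free_eval (@free_gen A) w = w.
Proof.
rewrite /free_eval; apply: val_inj; case: w => w /=.
elim: w => [|x w IHw] rw; first by rewrite /eval_word big_nil.
rewrite eval_word_cons.
have -> : eval_letter (@free_gen A) x = @FreeGroup A [:: x] isT.
  case: x {rw} => i [] //; exact: val_inj.
change (reduced_cons x (word (eval_word (@free_gen A) w)) = x :: w).
rewrite IHw; last exact: path_sorted rw.
by case: w rw {IHw} => //= y w /andP[/negPf ->].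
Qed.

(** * Transport along paths and its homotopy invariance *)

Section Transport.
Variables (R : realType) (X : topologicalType) (G : groupType).
Variable F : flat_atlas X G.
Local Notation I := (unitI R).
Local Notation unit_itv := [set t : R | 0 <= t <= 1].

(* Left translation of lifts makes [(a 0)^-1 * a 1] independent of the lift. *)
Definition transport (p : I -> X) (g : G) : Prop :=
  exists2 a : R -> G, flat_on F unit_itv (p \o @clampI R) a &
    ((a 0)^-1 * a 1%R)%g = g.

Lemma transport_uniq p g h : transport p g -> transport p h -> g = h.
Proof.
move=> [a ha <-] [b hb <-]; have := flat_on_uniq ler01 ha hb.
move/(congr1 (fun x => (a 0)^-1 * x * b 1%R)%g).
by rewrite mulKg mulgA mulgVK.
Qed.

Lemma transport_exists p : continuous p -> exists g, transport p g.
Proof.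
move=> cp.
have cpc : continuous (p \o @clampI R).
  by move=> t; apply: continuous_comp; [exact: clampI_continuous|exact: cp].
(* The path is spread to a square, constant in the second variable, and the lift is restricted to
   the bottom edge. *)
have [|a ha] := @flat_on_square _ _ F R (fun x => p (clampI x.1)).
  move=> x; apply: (@continuous_comp _ _ _ fst (p \o @clampI R)).
    exact: cvg_fst.
  exact: cpc.
exists ((a (0, 0))^-1 * a (1%R, 0))%g, (fun t => a (t, 0)) => //.
have c0 : continuous (fun t : R => (t, 0 : R)).
  by apply: pair_continuous => x; [exact: cvg_id|exact: cvg_cst].
apply: flat_onS (flat_on_comp c0 ha) => t /= t01; split=> //=.
by rewrite lexx ler01.
Qed.

Lemma transport_cst x : transport (fun=> x) 1.
Proof.
exists (fun=> 1%g); last by rewrite mulVg.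
by move=> t _ k _; near=> s => _.
Unshelve. all: by end_near.
Qed.

Lemma transport_in_chart p k : continuous p -> (forall t, chart F k (p t)) ->
  transport p (triv F k (p zero) / triv F k (p one)).
Proof.
move=> cp pk; exists (fun t => (triv F k (p (clampI t)))^-1)%g; last first.
  by rewrite invgK clamp_le0 // clamp_ge1.
apply: flat_on_triv => [t|t _]; last exact: pk.
by apply: continuous_comp; [exact: clampI_continuous|exact: cp].
Qed.

Lemma transport_rev p g : transport p g ->
  transport (fun t => p (clampI (1 - uval t))) g^-1.
Proof.
move=> [a ha <-]; exists (fun t => a (1 - t)).
  have c : continuous (fun t : R => 1 - t).
    exact: (@cosub_continuous R R 1 id (fun x => @cvg_id _ (nbhs x))).
  apply: (@eq_flat_on _ _ _ _ _ ((p \o @clampI R) \o (fun t : R => 1 - t))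
     _ (a \o (fun t : R => 1 - t))).
  - by move=> t; rewrite inE /= => t01; rewrite uval_clamp.
  - by [].
  - apply: flat_onS (flat_on_comp c ha) => t /= /andP[t0 t1].
    by apply/andP; split; lra.
by rewrite subr0 subrr invgM invgK.
Qed.

Lemma transport_concat p q g h : p one = q zero ->
  transport p g -> transport q h -> transport (concat_fun p q) (g * h).
Proof.
move=> pq [a ha <-] [b hb <-].
(* Translation by [m] makes the lift of [q] start where the lift of [p] ends. *)
pose m := (a 1%R * (b 0)^-1)%g.
pose A := [set t : R | 0 <= t <= 2^-1]; pose B := [set t : R | 2^-1 <= t <= 1].
exists (fun t => if `[< A t >] then a (2 * t)%R else m * b (2 * t - 1)%R)%g;
    last first.
  rewrite asboolT; last by rewrite /A /= lexx invr_ge0 ler0n.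
  rewrite asboolF; last by rewrite /A /= => /andP[_]; lra.
  rewrite mulr0 mulr1; have -> : 2 - 1 = 1 :> R by lra.
  by rewrite /m !mulgA.
have citv u v : closed [set t : R | u <= t <= v].
  have -> : [set t : R | u <= t <= v] = [set t | u <= t] `&` [set t | t <= v].
    by apply/seteqP; split=> t /= => [/andP|[? ?]] //; apply/andP.
  by apply: closedI; [exact: closed_ge|exact: closed_le].
have -> : unit_itv = A `|` B.
  apply/seteqP; split=> t; rewrite /A /B /=.
    by move=> /andP[t0 t1]; have [?|/ltW ?] := leP t 2^-1; [left|right];
      apply/andP.
  by case=> /andP[? ?]; apply/andP; split; lra.
have c2 : continuous (fun t : R => 2 * t).
  have cid : continuous (@id R) by move=> x; exact: cvg_id.
  have H := @scale_continuous R R 2 id cid.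
  exact: H.
have c21 : continuous (fun t : R => 2 * t - 1).
  exact: (@shift_continuous R R (-1) _ c2).
apply: flat_on_paste.
- exact: citv.
- exact: citv.
- move=> t; rewrite inE /A /B => -[/= /andP[_ ?] /andP[? _]].
  have -> : t = 2^-1 by apply/le_anti/andP.
  by rewrite divff ?pnatr_eq0 // subrr /m mulgVK.
- apply: (@eq_flat_on _ _ _ _ _ ((p \o @clampI R) \o (fun t : R => 2 * t))
     _ (a \o (fun t : R => 2 * t))) => //.
    move=> t; rewrite inE /A /= => /andP[t0 t1].
    by rewrite /concat_fun uval_clamp ?t1 //; apply/andP; split; lra.
  by apply: flat_onS (flat_on_comp c2 ha) => t /= /andP[? ?];
    apply/andP; split; lra.
- apply: (flat_on_mull m).
  apply: (@eq_flat_on _ _ _ _ _ ((q \o @clampI R) \o (fun t : R => 2 * t - 1))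
     _ (b \o (fun t : R => 2 * t - 1))) => //.
    move=> t; rewrite inE /B /= => /andP[t0 t1].
    rewrite /concat_fun uval_clamp; last by apply/andP; split; lra.
    case: ifP => // t2; have -> : t = 2^-1 by apply/le_anti; rewrite t2.
    by rewrite divff ?pnatr_eq0 // subrr clamp_le0 // clamp_ge1.
  by apply: flat_onS (flat_on_comp c21 hb) => t /= /andP[? ?];
    apply/andP; split; lra.
Qed.

(** A lift of the homotopy takes equal values at the ends of each vertical side, since that side is
    sent to a point; hence the two horizontal sides have the same transport. *)
Lemma transport_homotopic x y (p q : {path I from x to y}) g :
  homotopic p q -> transport p g -> transport q g.
Proof.
move=> [H [cH H0 H1 Hx Hy]] pg.
have cc : continuous (@clampI R) by exact: clampI_continuous.
have [|a ha] := @flat_on_square _ _ F R (fun u => H (clampI u.1, clampI u.2)).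
  move=> u; apply: (@continuous_comp _ _ _ _ H); last exact: cH.
  apply: pair_continuous => {}u.
    by apply: (@continuous_comp _ _ _ fst); [exact: cvg_fst|exact: cc].
  by apply: (@continuous_comp _ _ _ snd); [exact: cvg_snd|exact: cc].
have horizontal s : 0 <= s <= 1 ->
    flat_on F unit_itv (fun t => H (clampI t, clampI s)) (fun t => a (t, s)).
  move=> s01.
  have cs : continuous (fun t : R => (t, s)).
    by apply: pair_continuous => ?; [exact: cvg_id|exact: cvg_cst].
  by apply: flat_onS (flat_on_comp cs ha) => t /= t01; split.
(* The lift on the side is compared with a lift of the constant path, whose transport is 1. *)
have vertical t z : 0 <= t <= 1 -> (forall s, H (clampI t, s) = z) ->
    a (t, 0) = a (t, 1).
  move=> t01 Hz.
  have cs : continuous (fun s : R => (t, s)).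
    by apply: pair_continuous => ?; [exact: cvg_cst|exact: cvg_id].
  have f : flat_on F unit_itv (fun=> z) (fun s => a (t, s)).
    apply: (eq_flat_on (h := fun s => H (clampI t, clampI s))
      (a := fun s => a (t, s))) => //.
    by apply: flat_onS (flat_on_comp cs ha) => s /= s01; split.
  have [b hb b01] := transport_cst z.
  have := flat_on_uniq ler01 f hb.
  have -> : b 0 = b 1 by rewrite -[RHS](mulVKg (b 0)) b01 mulg1.
  by move/mulIg.
have i0 : 0 <= (0 : R) <= 1 by rewrite lexx ler01.
have i1 : 0 <= (1 : R) <= 1 by rewrite lexx ler01.
have pa : transport p ((a (0, 0))^-1 * a (1, 0)).
  exists (fun t => a (t, 0)) => //.
  apply: eq_flat_on (horizontal 0 i0) => // t _ /=.
  by rewrite (@clamp_le0 _ 0).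
rewrite (transport_uniq pg pa) (vertical 0 x) //; last first.
  by move=> s; rewrite clamp_le0.
rewrite (vertical 1 y) //; last by move=> s; rewrite clamp_ge1.
exists (fun t => a (t, 1)) => //.
apply: eq_flat_on (horizontal 1 i1) => // t _ /=.
by rewrite (@clamp_ge1 _ 1).
Qed.

(** Hiding the path lets holonomies multiply between varying endpoints, whereas [concat] only joins
    loops at one point. *)
Definition joined (x y : X) (g : G) : Prop :=
  exists p : I -> X, [/\ continuous p, p zero = x, p one = y & transport p g].

Lemma joined_mul x y z g h : joined x y g -> joined y z h -> joined x z (g * h).
Proof.
move=> [p [cp p0 p1 pg]] [q [cq q0 q1 qh]].
exists (concat_fun p q); split.
- by apply: concat_continuous; rewrite ?p1 ?q0.
- by rewrite concat_zero.
- by rewrite concat_one.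
- by apply: transport_concat; rewrite ?p1 ?q0.
Qed.

Lemma joined_inv x y g : joined x y g -> joined y x g^-1.
Proof.
move=> [p [cp p0 p1 pg]]; exists (fun t => p (clampI (1 - uval t))); split.
- move=> t.
  apply: (@continuous_comp _ _ _ (fun t : I => clampI (1 - uval t)) p);
    last exact: cp.
  apply: continuous_comp; last exact: clampI_continuous.
  by apply: cosub_continuous; exact: uval_continuous.
- by rewrite uval0 subr0 clamp_ge1.
- by rewrite uval1 subrr clamp_le0.
- exact: transport_rev.
Qed.

Section Pi1.
Variable x : X.
Local Notation pi1 := (pi1 R x).

Definition pi1_transport (c : pi1) (g : G) : Prop := transport (repr c) g.

Lemma pi1_transport_pi (p : {path I from x to x}) g :
  transport p g -> pi1_transport (\pi p) g.
Proof. by apply: transport_homotopic; apply: homotopic_sym; exact: pi1_repr. Qed.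

Lemma pi1_transport1 : pi1_transport 1%g 1%g.
Proof. by apply: pi1_transport_pi; exact: transport_cst. Qed.

Lemma pi1_transportM c d g h :
  pi1_transport c g -> pi1_transport d h -> pi1_transport (c * d)%g (g * h)%g.
Proof.
move=> cg dh; apply: pi1_transport_pi; apply: transport_concat => //.
exact: etrans (@path_one _ _ _ _ (repr c)) (esym (@path_zero _ _ _ _ (repr d))).
Qed.

Lemma pi1_transportV c g : pi1_transport c g -> pi1_transport c^-1%g g^-1%g.
Proof. by move=> cg; apply: pi1_transport_pi; exact: transport_rev. Qed.

Lemma joined_pi1_transport g : joined x x g -> exists c, pi1_transport c g.
Proof.
move=> [p [cp p0 p1 pg]].
pose l : {path I from x to x} := mk_path cp p0 p1.
by exists (\pi l); apply: pi1_transport_pi.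
Qed.

Lemma pi1_transport_eval (A : choiceType) (c : A -> pi1) (g : A -> G) w :
  (forall i, pi1_transport (c i) (g i)) ->
  pi1_transport (free_eval c w) (free_eval g w).
Proof.
move=> cg; rewrite /free_eval; elim: (word w) => [|l v IHv].
  by rewrite /eval_word !big_nil; exact: pi1_transport1.
rewrite !eval_word_cons; apply: pi1_transportM => //.
by rewrite /eval_letter; case: l.2 => //; exact: pi1_transportV.
Qed.

End Pi1.

End Transport.

(** * Free subgroups detected by holonomy *)

Lemma big_group_inj (G : groupType) (f : {multiplicative free_group 'I_2 -> G}) :
  injective f -> big_group G.
Proof.
move=> injf; exists (fun y => `[< exists x, f x = y >]).
  have f1 : f 1%g = 1%g by apply: (mulgI (f 1%g)); rewrite -gmulfM !mulg1.
  split; first by apply/asboolP; exists 1%g.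
  move=> _ _ /asboolP[x <-] /asboolP[y <-]; apply/asboolP.
  exists (x / y)%g; apply: (mulIg (f y)).
  by rewrite mulgVK -gmulfM mulgVK.
exists f; split => [x _|x y _ _|y /= /asboolP[x <-]].
- by apply/asboolP; exists x.
- exact: injf.
- by exists x.
Qed.

(** Loops with the given holonomies define a map from the free group, and the image of a word [w]
    has transport [w ^ d]. Transport is unique and conjugation is injective, so the map is
    injective. *)
Lemma big_group_pi1 (R : realType) (X : topologicalType) (x : X)
    (F : flat_atlas X (free_group 'I_2)) (d : free_group 'I_2) :
  (forall i, joined R F x x (free_gen i ^ d)) -> big_group (pi1 R x).
Proof.
move=> H.
have [c cH] : {c : 'I_2 -> pi1 R x & forall i, pi1_transport F (c i) (free_gen i ^ d)%g}.
  apply: (@choice _ _ (fun i c => pi1_transport F c (free_gen i ^ d)%g)) => i.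
  exact: joined_pi1_transport.
apply: (@big_group_inj _ (free_eval c)) => u v uv.
have := pi1_transport_eval u cH; have := pi1_transport_eval v cH.
rewrite !free_evalJ !free_eval_gen -uv => hv hu.
exact: conjg_inj (transport_uniq hu hv).
Qed.

(** * The twice punctured plane *)

Section ComplexTopology.
Variable R : realType.
Local Notation C := (Cplx R).

Lemma normr_Re (z : R[i]) : (`|complex.Re z|%:C <= `|z|)%C.
Proof.
case: z => x y; rewrite normc_def /= lecR -[`|x|]sqrtr_sqr ler_sqrt.
  by rewrite lerDl sqr_ge0.
by rewrite addr_ge0 ?sqr_ge0.
Qed.

Lemma normr_Im (z : R[i]) : (`|complex.Im z|%:C <= `|z|)%C.
Proof.
case: z => x y; rewrite normc_def /= lecR -[`|y|]sqrtr_sqr ler_sqrt.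
  by rewrite lerDr sqr_ge0.
by rewrite addr_ge0 ?sqr_ge0.
Qed.

Lemma dominated_continuous (f : C -> R) : {morph f : z w / z - w} ->
  (forall z : R[i], (`|f z|%:C <= `|z|)%C) -> continuous f.
Proof.
move=> fB fle z; apply/(@cvgrPdist_lt _ _ _ (nbhs z)) => e e0.
have : \forall w \near (z : C), `|z - w| < e%:C%C :> C.
  by apply/(@nbhs_ballP C C); exists e%:C%C => //=; rewrite ltcR.
apply: filterS => w zw; rewrite -ltcR.
by apply: le_lt_trans zw; rewrite -fB fle.
Qed.

Lemma Re_continuous : continuous (fun z : C => complex.Re z : R).
Proof. exact: dominated_continuous (raddfB _) normr_Re. Qed.

Lemma Im_continuous : continuous (fun z : C => complex.Im z : R).
Proof. exact: dominated_continuous (raddfB _) normr_Im. Qed.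

Lemma real_complex_continuous : continuous (fun x : R => x%:C%C : C).
Proof.
(* A positive radius in [Cplx R] is real, so its imaginary part [e'] vanishes. *)
move=> x; apply/cvgrPdist_lt => -[e e'] /=; rewrite ltcE /= => /andP[/eqP -> e0].
near=> y.
rewrite -rmorphB normc_def /= expr0n addr0 sqrtr_sqr ltcR.
by near: y; apply/nbhs_ballP; exists e.
Unshelve. all: by end_near.
Qed.

Lemma Complex_continuous (Y : topologicalType) (f g : Y -> R) :
  continuous f -> continuous g -> continuous (fun y => (f y +i* g y)%C : C).
Proof.
move=> cf cg.
have -> : (fun y => (f y +i* g y)%C : C) =
    (fun y => (f y)%:C%C + (g y)%:C%C * 'i%C : C).
  by apply/funext => y; simpc.
move=> y; apply: cvgD.
  by apply: continuous_comp; [exact: cf|exact: real_complex_continuous].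
apply: cvgM; last exact: cvg_cst.
by apply: continuous_comp; [exact: cg|exact: real_complex_continuous].
Qed.

End ComplexTopology.

(** Each listed point is avoided by passing to an open half of the interval that does not contain
    it. All choices of general position below rest on this. *)
Lemma avoid_seq (R : realFieldType) (s : seq R) (x y : R) : x < y ->
  exists2 c, x < c < y & c \notin s.
Proof.
elim: s x y => [|a s IHs] x y xy.
  by exists ((x + y) / 2) => //; apply/andP; split; lra.
have [am|am] := leP a ((x + y) / 2).
- have [|c /andP[mc cy] cs] := IHs ((x + y) / 2) y; first by lra.
  exists c; first by apply/andP; split; lra.
  by rewrite inE negb_or cs andbT gt_eqF //; lra.
- have [|c /andP[mc cy] cs] := IHs x ((x + y) / 2); first by lra.
  exists c; first by apply/andP; split; lra.
  by rewrite inE negb_or cs andbT lt_eqF //; lra.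
Qed.

(** * A flat bundle over the plane without 0 and 1, with three slit planes as charts *)

Section TwicePuncturedPlane.
Variables (R : realType) (G : groupType) (l r : G).
Local Notation C := (Cplx R).
Local Notation I := (unitI R).

Definition gap (k : option bool) : set R :=
  match k with
  | Some false => [set x | x < 0]
  | None => [set x | 0 < x < 1]
  | Some true => [set x | 1 < x]
  end.

Definition gap_label (k : option bool) : G :=
  match k with Some false => l | None => 1%g | Some true => r end.

Definition slit (k : option bool) : set C :=
  [set z | complex.Im z != 0 \/ gap k (complex.Re z)].

(* The section over [slit k]: equal to 1 above the real axis, so that crossing
   [gap k] upwards multiplies by [gap_label k]. *)
Definition slit_triv (k : option bool) (z : C) : G :=
  if 0 <= complex.Im z then 1%g else gap_label k.

Lemma gap_open k : open (gap k).
Proof.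
case: k => [[]|] /=; [exact: open_gt|exact: open_lt|].
have -> : [set x : R | 0 < x < 1] = [set x | 0 < x] `&` [set x | x < 1].
  by apply/seteqP; split=> x /= => [/andP|[? ?]] //; apply/andP.
by apply: openI; [exact: open_gt|exact: open_lt].
Qed.

Lemma slit_open k : open (slit k).
Proof.
have -> : slit k = (fun z : C => complex.Im z : R) @^-1` [set x | x != 0] `|`
    (fun z : C => complex.Re z : R) @^-1` gap k by [].
apply: openU.
  by apply: open_comp => [z _|]; [exact: Im_continuous|exact: open_neq].
by apply: open_comp => [z _|]; [exact: Re_continuous|exact: gap_open].
Qed.

Lemma slit_cover (z : C) : z != 0 -> z != 1 -> exists k, slit k z.
Proof.
rewrite !eq_complex /=; case: (eqVneq (complex.Im z) 0); last first.
  by move=> z0 _ _; exists None; left.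
rewrite !andbT => z0 zn0 zn1.
have [z_lt0|z_ge0] := ltP (complex.Re z) 0; first by exists (Some false); right.
have [z_gt1|z_le1] := ltP 1 (complex.Re z); first by exists (Some true); right.
by exists None; right; rewrite /= !lt_neqAle eq_sym zn0 z_ge0 zn1.
Qed.

(** Distinct gaps are disjoint, so a point common to two different slit planes is off the real axis,
    where the sign of the imaginary part is locally constant. *)
Lemma slit_compat i j (z : C) : slit i z -> slit j z ->
  \forall w \near z, ((slit_triv i w)^-1 * slit_triv j w =
                      (slit_triv i z)^-1 * slit_triv j z)%g.
Proof.
have [-> _ _|neq_ij] := eqVneq i j; first by near=> w; rewrite !mulVg.
move=> Ui Uj.
have z0 : complex.Im z != 0.
  case: Ui => // gi; case: Uj => // gj; move: neq_ij gi gj.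
  by case: i => [[]|]; case: j => [[]|] //= _; lra.
have : \forall w \near z, (0 <= complex.Im w) = (0 <= complex.Im z).
  have [zp|zn] := ltP 0 (complex.Im z).
    have : \forall w \near z, 0 < complex.Im w.
      apply: (@Im_continuous R z [set x | 0 < x]).
      by apply: open_nbhs_nbhs; split=> //; exact: open_gt.
    by apply: filterS => w w0; rewrite !ltW.
  have {z0}zn : complex.Im z < 0 by rewrite lt_neqAle z0.
  have : \forall w \near z, complex.Im w < 0.
    apply: (@Im_continuous R z [set x | x < 0]).
    by apply: open_nbhs_nbhs; split=> //; exact: open_lt.
  by apply: filterS => w w0; rewrite !leNgt w0 zn.
by apply: filterS => w wz; rewrite /slit_triv wz.
Unshelve. all: by end_near.
Qed.

(** * Holonomy of the pulled back bundle along lifted polygons *)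

Section Pullback.
Variables (X : topologicalType) (f : X -> C).
Hypotheses (cf : continuous f) (f0 : forall x, f x != 0) (f1 : forall x, f x != 1).

Lemma pullback_chart_open k : open (f @^-1` slit k).
Proof. by apply: open_comp => [x _|]; [exact: cf|exact: slit_open]. Qed.

Definition slit_atlas : flat_atlas X G :=
  {| chart_open := pullback_chart_open;
     chart_cover := fun x => slit_cover (f0 x) (f1 x);
     triv_compat := fun i j x Ui Uj => cf (slit_compat Ui Uj) |}.

(* [e] takes junk values on [s], so its continuity is only available along
   paths that avoid [s]. *)
Variables (e : C -> X) (s : seq C).
Hypothesis ce : forall p : I -> C, continuous p -> (forall t, p t \notin s) ->
  continuous (e \o p).
Hypothesis fe : forall z, z \notin s -> f (e z) = z.

Lemma joined_in_slit k (p : I -> C) : continuous p ->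
  (forall t, p t \notin s) -> (forall t, slit k (p t)) ->
  joined R slit_atlas (e (p zero)) (e (p one))
    (slit_triv k (p zero) / slit_triv k (p one)).
Proof.
move=> cp ps pk; exists (e \o p); split => //; first exact: ce.
have -> : (slit_triv k (p zero) / slit_triv k (p one) =
    triv slit_atlas k ((e \o p) zero) / triv slit_atlas k ((e \o p) one))%g.
  by rewrite /= !fe.
by apply: transport_in_chart => [|t]; [exact: ce|rewrite /= fe].
Qed.

Definition segment (z w : C) (t : I) : C :=
  ((complex.Re z * (1 - uval t) + complex.Re w * uval t) +i*
   (complex.Im z * (1 - uval t) + complex.Im w * uval t))%C.

Lemma segment_continuous z w : continuous (segment z w).
Proof.
have c a b : continuous (fun t : I => a * (1 - uval t) + b * uval t).
  have c1 : continuous (fun t : I => 1 - uval t).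
    by apply: cosub_continuous; exact: uval_continuous.
  have ca := @scale_continuous R _ a _ c1.
  have cb := @scale_continuous R _ b _ (@uval_continuous R).
  by move=> t; exact: (cvgD (ca t) (cb t)).
by apply: Complex_continuous; exact: c.
Qed.

Lemma segment0 z w : segment z w zero = z.
Proof.
by case: z => x y; rewrite /segment uval0 subr0 !mulr1 !mulr0 !addr0.
Qed.

Lemma segment1 z w : segment z w one = w.
Proof.
by case: w => x y; rewrite /segment uval1 subrr !mulr1 !mulr0 !add0r.
Qed.

Lemma joined_segment k z w : (forall t, segment z w t \notin s) ->
  (forall t, slit k (segment z w t)) ->
  joined R slit_atlas (e z) (e w) (slit_triv k z / slit_triv k w).
Proof.
move=> zs zk; have := joined_in_slit (@segment_continuous z w) zs zk.
by rewrite segment0 segment1.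
Qed.

Lemma joined_horizontal x x' y : y != 0 -> y \notin map (@complex.Im R) s ->
  joined R slit_atlas (e (x +i* y)%C) (e (x' +i* y)%C) 1.
Proof.
move=> y0 ys.
have imE t : complex.Im (segment (x +i* y)%C (x' +i* y)%C t) = y by rewrite /=; ring.
(* Any slit plane would serve, since the segment stays off the real axis and both ends carry the
   same label. *)
have := @joined_segment None (x +i* y)%C (x' +i* y)%C.
rewrite {1 2}/slit_triv /= divgg; apply => t; last by left; rewrite imE.
by apply: contraNN ys => /(map_f (@complex.Im R)); rewrite imE.
Qed.

Lemma joined_vertical k x y y' : gap k x -> x \notin map (@complex.Re R) s ->
  joined R slit_atlas (e (x +i* y)%C) (e (x +i* y')%C)
    ((if (0 <= y)%R then 1 else gap_label k) /
     (if (0 <= y')%R then 1 else gap_label k))%g.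
Proof.
move=> kx xs.
have reE t : complex.Re (segment (x +i* y)%C (x +i* y')%C t) = x by rewrite /=; ring.
apply: (@joined_segment k (x +i* y)%C (x +i* y')%C) => t; last by right; rewrite reE.
by apply: contraNN xs => /(map_f (@complex.Re R)); rewrite reE.
Qed.

(* The loops are the boundaries of two rectangles around 0 and 1 sharing the
   vertical edge through [c2], run from a corner [c2 +i* h2] that sees [b]. *)
Lemma joined_generators (b : C) : b \notin s -> exists d : G,
  joined R slit_atlas (e b) (e b) (l^-1 ^ d)%g /\
  joined R slit_atlas (e b) (e b) (r ^ d)%g.
Proof.
move=> bs.
have [h2 /andP[h20 _]] := avoid_seq (map (@complex.Im R) (b :: s)) (@ltr01 R).
rewrite inE negb_or => /andP[h2b h2s].
have [|h1 /andP[_ h10] h1s] := @avoid_seq R (map (@complex.Im R) s) (-1) 0.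
  by lra.
have [|c1 /andP[_ c10] c1s] := @avoid_seq R (map (@complex.Re R) s) (-1) 0.
  by lra.
have [|c3 /andP[c31 _] c3s] := @avoid_seq R (map (@complex.Re R) s) 1 2.
  by lra.
(* The abscissa at height [h2] of the line through [b] and [z]: if [c2] avoids it, the segment from
   [b] to the corner misses [z]. When [z] has the height of [b] the value is junk but harmless, as
   the segment meets that height only at [b]. *)
pose slope (z : C) := complex.Re b + (complex.Re z - complex.Re b) *
  (h2 - complex.Im b) / (complex.Im z - complex.Im b).
have [c2 /andP[c20 c21]] :=
  avoid_seq (map (@complex.Re R) s ++ map slope s) (@ltr01 R).
rewrite mem_cat negb_or => /andP[c2s c2slope].
have h1F : (0 <= h1) = false by rewrite leNgt h10.
have h2T : 0 <= h2 by rewrite ltW.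
have h1n : h1 != 0 by rewrite lt_eqF.
have h2n : h2 != 0 by rewrite gt_eqF.
pose P x y : C := (x +i* y)%C.
have bP t : segment b (P c2 h2) t \notin s.
  apply/negP => zs; set z := segment _ _ t in zs.
  have imz : complex.Im z - complex.Im b = uval t * (h2 - complex.Im b).
    by rewrite /z /=; ring.
  have rez : complex.Re z - complex.Re b = uval t * (c2 - complex.Re b).
    by rewrite /z /=; ring.
  have hb : h2 - complex.Im b != 0 by rewrite subr_eq0.
  have [t0|t0] := eqVneq (uval t) 0.
    have tE : t = zero by rewrite -(uvalK t) t0 clamp_le0.
    by move: zs; rewrite /z tE segment0; apply/negP.
  move/negP: c2slope; apply; apply/mapP; exists z => //.
  rewrite /slope imz rez; field.
  by rewrite hb t0.
(* The holonomy of this segment is not computed: it only conjugates both loops by the same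
   element. *)
have [d bd] : exists d, joined R slit_atlas (e b) (e (P c2 h2)) d.
  have cp := ce (@segment_continuous b (P c2 h2)) bP.
  have [d bd] := transport_exists slit_atlas cp.
  exists d, (e \o segment b (P c2 h2)); split=> //=.
    by rewrite segment0.
  by rewrite segment1.
(* Left along [h2], down through the negative axis, right along [h1], up through the middle gap: the
   only contribution is the downward crossing, [l^-1]. *)
have lJ : joined R slit_atlas (e (P c2 h2)) (e (P c2 h2)) l^-1.
  have e1 := joined_horizontal c2 c1 h2n h2s.
  have e2 := @joined_vertical (Some false) c1 h2 h1 c10 c1s.
  have e3 := joined_horizontal c1 c2 h1n h1s.
  have gc2 : gap None c2 by rewrite /= c20 c21.
  have e4 := @joined_vertical None c2 h1 h2 gc2 c2s.
  move: e2 e4; rewrite h1F h2T /= divgg div1g => e2 e4.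
  have := joined_mul e1 (joined_mul e2 (joined_mul e3 e4)).
  by rewrite mul1g !mulg1.
(* Down through the middle gap and up to the right of 1, so that only the upward crossing
   contributes. *)
have rJ : joined R slit_atlas (e (P c2 h2)) (e (P c2 h2)) r.
  have gc2 : gap None c2 by rewrite /= c20 c21.
  have e1 := @joined_vertical None c2 h2 h1 gc2 c2s.
  have e2 := joined_horizontal c2 c3 h1n h1s.
  have e3 := @joined_vertical (Some true) c3 h1 h2 c31 c3s.
  have e4 := joined_horizontal c3 c2 h2n h2s.
  move: e1 e3; rewrite h1F h2T /= divgg divg1 => e1 e3.
  have := joined_mul e1 (joined_mul e2 (joined_mul e3 e4)).
  by rewrite !mul1g mulg1.
exists d^-1%g; rewrite !conjgE !invgK.
by split; apply: joined_mul bd (joined_mul _ (joined_inv bd)).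
Qed.

End Pullback.

End TwicePuncturedPlane.

Lemma big_group_over_punctured_plane (R : realType) (X : topologicalType)
    (f : X -> Cplx R) (e : Cplx R -> X) (s : seq (Cplx R)) (b : Cplx R) :
  continuous f -> (forall x, f x != 0) -> (forall x, f x != 1) ->
  (forall p : unitI R -> Cplx R, continuous p -> (forall t, p t \notin s) ->
     continuous (e \o p)) ->
  (forall z, z \notin s -> f (e z) = z) -> b \notin s ->
  big_group (pi1 R (e b)).
Proof.
move=> cf f0 f1 ce fe bs; pose g (i : 'I_2) := free_gen i.
(* The loop around 0 crosses its labelled gap downwards, so that gap is labelled by the inverse of a
   generator. *)
have [d [d0 d1]] := joined_generators (g ord0)^-1 (g ord_max) cf f0 f1 ce fe bs.
apply: big_group_pi1 => i.
have [i0|->] : i = ord0 \/ i = ord_max.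
  by case: i => [[|[|]]] //= ?; [left|right]; exact: val_inj.
  by rewrite i0; move: d0; rewrite invgK; exact: (fun x => x).
exact: d1.
Qed.

(** * Pencils of lines *)

(** The forms vanishing at [P] make up a plane with basis [a1], [a3], in which [a2] has two nonzero
    coordinates. Rescaling [a1] by [x] puts the three lines over the values 0, 1 and infinity of the
    ratio of [x *: a1] to [a3]; [w] is a direction in which [a3] is constant and [x *: a1] grows at
    unit rate. *)
Lemma pencil_coordinates (K : fieldType) (P : 'rV[K]_3) (a1 a2 a3 : 'cV[K]_3) :
  P != 0 -> P *m a1 = 0 -> P *m a2 = 0 -> P *m a3 = 0 -> a3 != 0 ->
  (forall c, a1 != c *: a3) -> (forall c, a2 != c *: a1) ->
  (forall c, a2 != c *: a3) ->
  exists x y (w : 'rV[K]_3), [/\ x != 0, y != 0, w *m (x *: a1) = 1%:M,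
    w *m a3 = 0 & a2 = y *: (a3 - x *: a1)].
Proof.
move=> P0 Pa1 Pa2 Pa3 a30 n13 n21 n23.
pose A := col_mx a1^T a3^T.
have freeA : row_free A.
  apply: inj_row_free => v; rewrite -[v]hsubmxK mul_row_col.
  set x := lsubmx v; set y := rsubmx v.
  rewrite [x]mx11_scalar [y]mx11_scalar !mul_scalar_mx => xy.
  have x0 : x 0 0 = 0.
    apply/eqP; apply: contraT => xn0; move/negP: (n13 (- (x 0 0)^-1 * y 0 0)).
    case; apply/eqP; apply: (can_inj (@trmxK _ _ _)); rewrite linearZ /=.
    move/eqP: xy; rewrite addr_eq0 => /eqP /(congr1 (GRing.scale (x 0 0)^-1)).
    by rewrite scalerA mulVf // scale1r => ->; rewrite scalerN scalerA mulNr scaleNr.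
  have y0 : y 0 0 = 0.
    move/eqP: xy; rewrite x0 scale0r add0r scaler_eq0 trmx_eq0 (negPf a30) orbF.
    by move/eqP.
  by rewrite x0 y0 !raddf0 row_mx0.
have AP : (A <= kermx P^T)%MS.
  by apply/sub_kermxP; rewrite mul_col_mx -!trmx_mul Pa1 Pa3 trmx0 col_mx0.
have rankA : \rank A = 2 by move/eqP: freeA.
have rankP : \rank (kermx P^T) = 2.
  by rewrite mxrank_ker mxrank_tr rank_rV P0.
(* The span of the two forms lies in the annihilator of [P] and both have rank 2, so they
   coincide. *)
have a2A : (a2^T <= A)%MS.
  have [_ /esym] := mxrank_leqif_sup AP.
  rewrite rankA rankP eqxx => kA; apply: submx_trans kA.
  by apply/sub_kermxP; rewrite -trmx_mul Pa2 trmx0.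
have [D a2D] := submxP a2A.
have [l [m a2E]] : exists l m, a2 = l *: a1 + m *: a3.
  exists (lsubmx D 0 0), (rsubmx D 0 0); apply: (can_inj (@trmxK _ _ _)).
  rewrite a2D -{1}[D]hsubmxK mul_row_col linearD !linearZ /=.
  by rewrite {1}[lsubmx D]mx11_scalar {1}[rsubmx D]mx11_scalar !mul_scalar_mx.
have l0 : l != 0.
  apply: contraTneq isT => l0; move/negP: (n23 m).
  by rewrite a2E l0 scale0r add0r eqxx.
have m0 : m != 0.
  apply: contraTneq isT => m0; move/negP: (n21 l).
  by rewrite a2E m0 scale0r addr0 eqxx.
have [B AB] := row_freeP freeA.
(* The first column of a right inverse of [A] is dual to [a1] and killed by [a3]. *)
pose w0 := (B *m col_mx (1%:M : 'M_1) 0)^T.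
have [w01 w03] : w0 *m a1 = 1%:M /\ w0 *m a3 = 0.
  have : A *m (B *m col_mx (1%:M : 'M_1) 0) = col_mx 1%:M 0.
    by rewrite mulmxA AB mul1mx.
  rewrite mul_col_mx => /eq_col_mx[e1 e3].
  split; apply: (can_inj (@trmxK _ _ _)); rewrite trmx_mul trmxK.
    by rewrite e1 trmx1.
  by rewrite e3 trmx0.
have x0 : - l / m != 0 by rewrite mulf_neq0 ?oppr_eq0 ?invr_eq0.
exists (- l / m), m, ((- l / m)^-1 *: w0); split => //.
- by rewrite -scalemxAr -scalemxAl scalerA mulfV // scale1r w01.
- by rewrite -scalemxAl w03 scaler0.
- rewrite scalerBr scalerA mulrC mulfVK // scaleNr opprK a2E addrC //.
Qed.

Section Pencil.
Variable R : realType.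
Local Notation C := (Cplx R).
Local Notation CP2 := (CP2 R).

Definition form (a : 'cV[C]_3) (v : 'rV[C]_3) : C := (v *m a) 0 0.

Lemma form_eq0 a v : form a v = 0 <-> v *m a = 0.
Proof.
rewrite /form; split=> [va|->]; last by rewrite mxE.
by apply/matrixP => i j; rewrite !ord1 va mxE.
Qed.

Lemma formZl a c v : form a (c *: v) = c * form a v.
Proof. by rewrite /form -scalemxAl mxE. Qed.

Lemma formDl a v w : form a (v + w) = form a v + form a w.
Proof. by rewrite /form mulmxDl mxE. Qed.

Lemma form_continuous a : continuous (form a).
Proof.
have ci i : continuous (fun v : 'rV[C]_3 => v 0 i * a i 0).
  have cc := @coord_continuous C 1 3 0 i.
  by move=> v; exact: (cvgM (cc v) (cvg_cst (a i 0))).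
have -> : form a = (fun v => v 0 0 * a 0 0 + (v 0 1 * a 1 0 + v 0 2 * a 2 0)).
  apply/funext => v; rewrite /form mxE !big_ord_recl big_ord0 addr0.
  by congr (_ + (v _ _ * a _ _ + v _ _ * a _ _)); exact: val_inj.
by move=> v; exact: (cvgD (ci 0 v) (cvgD (ci 1 v) (ci 2 v))).
Qed.

(** The scale of the chosen coordinates cancels in the quotient; on the line of [b] the value is 0
    by default. *)
Definition homogeneous_ratio a b (q : CP2) : C :=
  form a (val (repr q : @nonzero_vector R)) / form b (val (repr q : @nonzero_vector R)).

Lemma repr_pi (v : @nonzero_vector R) : exists2 c : C, c != 0 &
  val v = c *: val (repr (\pi_CP2 v) : @nonzero_vector R).
Proof.
have /eqmodP/asboolP[c c0 vE] :
  \pi_{eq_quot @proportional_rel R} (repr (\pi_CP2 v)) =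
  \pi_{eq_quot @proportional_rel R} v by exact: (reprK (\pi_CP2 v)).
by exists c.
Qed.

Lemma form_repr_pi_eq0 a (v : @nonzero_vector R) :
  (form a (val (repr (\pi_CP2 v) : @nonzero_vector R)) == 0) =
  (form a (val v) == 0).
Proof.
by have [c c0 ->] := repr_pi v; rewrite formZl mulf_eq0 (negPf c0).
Qed.

Lemma homogeneous_ratio_pi a b (v : @nonzero_vector R) :
  homogeneous_ratio a b (\pi_CP2 v) = form a (val v) / form b (val v).
Proof.
rewrite /homogeneous_ratio; have [c c0 ->] := repr_pi v.
by rewrite !formZl -mulf_div divff // mul1r.
Qed.

(** Openness in the quotient topology is tested on nonzero vectors, where the ratio is a quotient of
    continuous linear forms. *)
Lemma homogeneous_ratio_continuous a b (q : CP2) :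
  form b (val (repr q : @nonzero_vector R)) != 0 ->
  {for q, continuous (homogeneous_ratio a b)}.
Proof.
move=> bq O; rewrite nbhsE => -[O' [oO' O'q] O'O].
(* The nonvanishing of the denominator is built into [S] so that its preimage is open at all its
   points. *)
pose S := [set x : CP2 | form b (val (repr x : @nonzero_vector R)) != 0 /\
  O' (homogeneous_ratio a b x)].
suff oS : open S.
  apply: (@filterS _ _ _ S); first by move=> x [_ /O'O].
  by apply: open_nbhs_nbhs; split.
rewrite /open /= /quotient_open openE => v [].
rewrite form_repr_pi_eq0 homogeneous_ratio_pi => bv O'v.
have cform d : {for v, continuous (fun x : @nonzero_vector R => form d (val x))}.
  apply: (@continuous_comp _ _ _ (fun x : @nonzero_vector R => val x) (form d)).
    exact: initial_continuous.
  exact: form_continuous.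
have b_near : \forall x \near v, form b (val x) != 0.
  exact: (cvgr_neq0 _ (cform b) bv).
have O_near : \forall x \near v, O' (form a (val x) / form b (val x)).
  have : (fun x : @nonzero_vector R => form a (val x) / form b (val x)) x @[x --> v]
      --> form a (val v) / form b (val v).
    exact: (cvgM (cform a) (cvgV bv (cform b))).
  by apply; apply: open_nbhs_nbhs.
rewrite /interior; apply: filterS2 b_near O_near => x bx Ox.
by split; rewrite ?form_repr_pi_eq0 ?homogeneous_ratio_pi.
Qed.

Lemma lineZ (c : C) (a : 'cV[C]_3) : c != 0 -> line (c *: a) = line a.
Proof.
move=> c0; apply/seteqP; split=> q; rewrite /line /= -scalemxAr.
  by move/eqP; rewrite scaler_eq0 (negPf c0) => /eqP.
by move=> ->; rewrite scaler0.
Qed.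

Lemma line_neq (a b : 'cV[C]_3) : a != 0 -> line a <> line b -> forall c, a != c *: b.
Proof.
move=> a0 ab c; apply/eqP => acb; apply: ab; rewrite acb lineZ //.
by apply: contraNneq a0 => c0; rewrite acb c0 scale0r.
Qed.

(** The ratio from [pencil_coordinates] is the projection from [p], and the line through [u0] in
    direction [w] gives its section. Stating [A] up to an equation covers the affine and the
    projective complement alike. *)
Lemma big_group_pencil_complement (Ls : set (set CP2)) (A : set CP2)
    (l1 l2 l3 : set CP2) (p u0 : CP2) (u0A : u0 \in A) :
  finite_set Ls -> Ls `<=` @projective_line R -> A = ~` union_lines Ls ->
  Ls l1 -> Ls l2 -> Ls l3 -> l1 <> l2 -> l1 <> l3 -> l2 <> l3 ->
  l1 p -> l2 p -> l3 p -> big_group (pi1 R (SigSub u0A : A)).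
Proof.
move=> finLs projLs AE Ls1 Ls2 Ls3 n12 n13 n23 p1 p2 p3.
have [a1 a10 l1E] := projLs _ Ls1; have [a2 a20 l2E] := projLs _ Ls2.
have [a3 a30 l3E] := projLs _ Ls3; subst l1 l2 l3.
have P0 : val (repr p : @nonzero_vector R) != 0.
  exact: set_mem (valP (repr p : @nonzero_vector R)).
have [x [y [w [x0 y0 wx w3 a2E]]]] := pencil_coordinates P0 p1 p2 p3 a30
  (line_neq a10 n13) (line_neq a20 (nesym n12)) (line_neq a20 n23).
have {}wx : form (x *: a1) w = 1 by rewrite /form wx mxE.
have {}w3 : form a3 w = 0 by apply/form_eq0.
have AP q l : A q -> Ls l -> ~ l q.
  by rewrite AE => Aq Lsl lq; apply: Aq; exists l.
have form3 q : A q -> form a3 (val (repr q : @nonzero_vector R)) != 0.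
  by move=> Aq; apply/eqP => /form_eq0; exact: AP Ls3.
pose f (q : A) : C := homogeneous_ratio (x *: a1) a3 (set_val q).
have qA (q : A) : A (set_val q) by exact: set_valP.
have cf : continuous f.
  move=> q; apply: (@continuous_comp _ _ _ (@set_val _ A)).
    exact: initial_continuous.
  by apply: homogeneous_ratio_continuous; apply: form3; exact: (qA q).
have f0 q : f q != 0.
  rewrite mulf_neq0 ?invr_eq0 ?(form3 _ (qA q)) //.
  apply/eqP => /form_eq0 xq; apply: (AP _ _ (qA q) Ls1).
  by rewrite -(lineZ a1 x0).
(* Ratio 1 makes the form [a3 - x *: a1] vanish, which puts the point on the second line. *)
have f1 q : f q != 1.
  apply/eqP => /(divr1_eq) fq; apply: (AP _ _ (qA q) Ls2); apply/form_eq0.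
  rewrite a2E /form -scalemxAr mxE mulmxBr mxE [X in _ + X]mxE.
  by rewrite -/(form _ _) -/(form _ _) fq subrr mulr0.
have Au0 : A u0 by exact: set_mem.
pose v0 := val (repr u0 : @nonzero_vector R).
pose v : 'rV[C]_3 := (form a3 v0)^-1 *: v0.
have v3 : form a3 v = 1 by rewrite formZl mulVf // form3.
pose b := form (x *: a1) v.
(* Along this line [a3] stays 1, which keeps it away from [p], and [x *: a1] equals the parameter
   [z]; at [z = b] it passes through [u0]. *)
pose E z : 'rV[C]_3 := v + (z - b) *: w.
have cE : continuous E.
  have cs : continuous (fun z : C => z - b).
    by move=> z; exact: (cvgB (@cvg_id _ (nbhs z)) (cvg_cst b)).
  by move=> z; exact: (cvgD (cvg_cst v) (cvgZr_tmp (a := w) (cs z))).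
have E3 z : form a3 (E z) = 1 by rewrite formDl (formZl _ _ w) w3 mulr0 addr0.
have E1 z : form (x *: a1) (E z) = z.
  by rewrite formDl (formZl _ _ w) wx mulr1 addrC subrK.
have E0 z : E z \in @nonzero_vector R.
  rewrite inE /nonzero_vector /=; apply/eqP => Ez.
  by have /eqP := E3 z; rewrite Ez /form mul0mx mxE eq_sym oner_eq0.
pose lift z : @nonzero_vector R := SigSub (E0 z).
pose pt z : CP2 := \pi_CP2 (lift z).
have ptb : pt b = u0.
  rewrite -[RHS]reprK; apply/eqmodP/asboolP.
  exists (form a3 v0); first exact: form3.
  by rewrite /= /E subrr scale0r addr0 scalerA mulfV ?scale1r // form3.
have v_notin a : Ls (line a) -> form a v != 0.
  move=> Lsa; rewrite formZl mulf_neq0 ?invr_eq0 ?form3 //.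
  by apply/eqP => /form_eq0; exact: AP Lsa.
(* On the section the form of each line of the family is affine in [z] and nonzero at [b], so it has
   at most one zero, which [xget] selects. *)
have : finite_set [set z | ~ A (pt z)].
  apply: sub_finite_set (finite_image (fun l => xget 0 [set z | l (pt z)]) finLs).
  move=> z /=; rewrite AE => /contrapT[l Lsl lz]; exists l => //.
  apply: xget_unique => // z' lz'.
  have [a a0 lE] := projLs _ Lsl; subst l.
  move/lineE/form_eq0: lz; move/lineE/form_eq0: lz'.
  rewrite /= !formDl !(formZl _ _ w) => z'0 z0.
  have wa : form a w != 0.
    apply: contraNneq (v_notin _ Lsl) => wa.
    by move: z0; rewrite wa mulr0 addr0 => ->.
  apply: (addIr (- b)); apply: (mulIf wa); apply: (addrI (form a v)).
  by rewrite z0 z'0.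
move=> /finite_seqP[s sE].
have sA z : z \notin s -> A (pt z).
  move=> zs; apply: contrapT => zA; move/negP: zs; apply.
  by have : [set` s] z by rewrite -sE.
have bs : b \notin s.
  by apply/negP => bs; have : [set` s] b by []; rewrite -sE /= ptb.
(* At the finitely many parameters where the section leaves [A], the base point is the default
   value. *)
pose e z : A := insubd (SigSub u0A : A) (pt z).
have eE z : z \notin s -> set_val (e z) = pt z.
  by move=> zs; apply: insubdK; apply: mem_set; exact: sA.
have <- : e b = SigSub u0A by apply: val_inj; exact: etrans (eE _ bs) ptb.
apply: (@big_group_over_punctured_plane R A f e s b) => // [q cq qs|z zs].
  apply: continuous_comp_initial.
  have -> : (@set_val _ A) \o (e \o q) = pt \o q.
    by apply/funext => t /=; exact: eE.
  move=> t; apply: continuous_comp; first exact: cq.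
  apply: continuous_comp; last exact: pi_continuous.
  exact: (continuous_comp_initial (f := lift) cE).
by rewrite /f eE // homogeneous_ratio_pi E1 E3 divr1.
Qed.

End Pencil.

Local Close Scope quotient_scope.
Local Close Scope ring_scope.
Local Open Scope card_scope.

(** * Both complements from three concurrent lines *)

Theorem corollary6p1p2 (R : realType) (n k : nat) (L : set (set (CP2 R)))
    (linf : set (CP2 R))
    (arrangementL : real_line_arrangement L)
    (cardL : L #= `I_n)
    (line_linf : projective_line linf)
    (linf_notin : ~ L linf)
    (affine_intersections : intersection_points L `<=` C2 linf)
    (k_ge1 : 1 <= k)
    (card_multiple : multiple_points L #= `I_k)
    (class_on_line : forall C : set (CP2 R), multiple_class L C ->
       exists2 l : set (CP2 R), L l & C `<=` l)
    (u0 : CP2 R)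
    (u0_affine : u0 \in C2 linf `\` union_lines L)
    (u0_projective : u0 \in [set: CP2 R] `\` union_lines L) :
  big_group (pi1 R (SigSub u0_affine : C2 linf `\` union_lines L)) /\
  big_group (pi1 R (SigSub u0_projective : [set: CP2 R] `\` union_lines L)).
Proof.
have [p [l1 [l2 [l3 [[L1 p1] [L2 p2] [L3 p3] [n12 n13 n23]]]]]] :
    exists p l1 l2 l3, [/\ L l1 /\ l1 p, L l2 /\ l2 p, L l3 /\ l3 p &
      [/\ l1 <> l2, l1 <> l3 & l2 <> l3]].
  have [p mp] : multiple_points L !=set0.
    apply/set0P/eqP => L0; move: card_multiple.
    rewrite L0 card_eq_sym card_eq0 => /eqP k0.
    by have : `I_k 0 by []; rewrite k0.
  (* An injection of [I_3] into the lines through [p] supplies three distinct ones. *)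
  have /pcard_leP[f] := mp.
  have Lf i : (i < 3)%N -> L (f i) /\ f i p by move=> i3; exact: (@funS _ _ _ _ f i i3).
  have nf i j : (i < 3)%N -> (j < 3)%N -> i != j -> f i <> f j.
    move=> i3 j3 /eqP ij fij; apply: ij.
    by apply: (@inj _ _ `I_3 f) => //; apply: mem_set.
  exists p, (f 0), (f 1), (f 2); split; [exact: Lf..|].
  by split; exact: nf.
have proj : L `<=` @projective_line R.
  move=> l /(proj2 arrangementL)[a a0 ->]; exists (map_mx (fun t => t%:C%C) a) => //.
  apply: contraNneq a0 => aC0; apply/eqP/matrixP => i j.
  by have /matrixP/(_ i j) := aC0; rewrite !mxE => -[].
have finL := proj1 arrangementL.
split; last first.
  apply: (@big_group_pencil_complement _ L _ l1 l2 l3 p) => //.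
  by rewrite setTD.
(* The affine complement is the projective complement of the family enlarged by [linf]. *)
apply: (@big_group_pencil_complement _ (linf |` L) _ l1 l2 l3 p) => //; try by right.
- by rewrite finite_setU; split.
- by move=> l [->|/proj].
- by rewrite /union_lines bigcup_setU1 setCU setDE.
Qed.
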